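(* Let $i\in\mathbb{C}$ be the imaginary unit, and put $$\varphi_5(x)=\frac{4i\,x\,(x-1)\,(4x-2-11i)^4}{(8x-4+3i)^5}.$$ Then $\varphi_5:\mathbb{P}^1\to\mathbb{P}^1$ is a covering of degree $6$ which defines a pull-back transformation from a hypergeometric equation with local exponent differences $(1/2,1/4,1/5)$ (in some order at the singular points) to a hypergeometric equation with local exponent differences $(1/4,1/4,1/5)$ (in some order). Moreover, in a neighborhood of $x=0$ the following identities hold: $${}_2F_1\!\left(\tfrac{3}{20},\tfrac{7}{20};\tfrac34;x\right)=\left(1-\tfrac{8(4+3i)}{25}x\right)^{-1/8}{}_2F_1\!\left(\tfrac1{40},\tfrac{9}{40};\tfrac34;\varphi_5(x)\right),$$ $${}_2F_1\!\left(\tfrac{3}{20},\tfrac25;\tfrac45;x\right)=(1-x)^{-1/40}\left(1-\tfrac{2+11i}{4}x\right)^{-1/10}{}_2F_1\!\left(\tfrac1{40},\tfrac{11}{40};\tfrac45;\tfrac{1}{\varphi_5(1/x)}\right).$$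
   Context: ${}_2F_1(A,B;C;z)$ is the Gauss hypergeometric function, a solution of the hypergeometric equation $z(1-z)y''+(C-(A+B+1)z)y'-AB\,y=0$, whose local exponent differences at $z=0,1,\infty$ are (up to sign) $1-C$, $C-A-B$, $A-B$. A pull-back transformation is $z\mapsto\varphi(x)$, $y(z)\mapsto Y(x)=\theta(x)y(\varphi(x))$ with $\varphi$ a rational function and $\theta$ a product of powers of rational functions; it is said to be defined by the covering $\varphi$ (with suitable $\theta$), and it transforms the equation for $y$ into the equation for $Y$. The identities are between analytic functions near $x=0$; fractional powers of functions with value $1$ at $x=0$ denote the branch with value $1$ at $x=0$. *)

(* Defs.v *)
From Stdlib Require Import Reals Factorial List Permutation.
From Coquelicot Require Import Coquelicot.
Import ListNotations.

Open Scope C_scope.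

(** * Complex exponential, principal logarithm and principal powers *)

Definition Cexp (z : C) : C :=
  ((exp (Re z) * cos (Im z))%R, (exp (Re z) * sin (Im z))%R).

(* Principal argument, in (-PI, PI], of a nonzero complex number. *)
Definition Carg (z : C) : R :=
  if Rle_dec 0 (Im z) then acos (Re z / Cmod z) else (- acos (Re z / Cmod z))%R.

Definition Clog (z : C) : C := (ln (Cmod z), Carg z).

(* Principal value of z^a, for z <> 0.  It is holomorphic in z off the negative
   real axis and equals 1 at z = 1.  Hence, if g is continuous at 0 and
   g 0 = 1, then near 0 the function x |-> Cpower (g x) a is the branch of g^a
   with value 1 at x = 0. *)
Definition Cpower (z a : C) : C := Cexp (a * Clog z).

(** * The Gauss hypergeometric series *)

Fixpoint Cpoch (a : C) (n : nat) : C :=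
  match n with
  | O => 1
  | S m => Cpoch a m * (a + INR m)
  end.

(* Sum of a convergent complex series. *)
Definition CSeries (u : nat -> C) : C :=
  (Series (fun n => Re (u n)), Series (fun n => Im (u n))).

Definition hyp2F1 (a b c z : C) : C :=
  CSeries (fun n => Cpoch a n * Cpoch b n / (Cpoch c n * INR (fact n)) * z ^ n).

(** * Hypergeometric equations *)

Record hge := Hge { hgA : C; hgB : C; hgC : C }.

(* Holomorphic functions are exactly those that are complex differentiable
   near the point; requiring two derivatives is no restriction. *)
Definition twice_derivable (y : C -> C) (z : C) : Prop :=
  locally z (fun w => ex_derive y w /\ ex_derive (C_derive y) w).

Definition satisfies_at (E : hge) (y : C -> C) (z : C) : Prop :=
  z * (1 - z) * C_derive (C_derive y) z
  + (hgC E - (hgA E + hgB E + 1) * z) * C_derive y z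
  - hgA E * hgB E * y z = 0.

(* At the singular points 0, 1 and infinity, in this order. *)
Definition exponent_differences (E : hge) : list C :=
  [1 - hgC E; hgC E - hgA E - hgB E; hgA E - hgB E].

(* Exponent differences are only defined up to sign; the triple [e] is assigned
   to the singular points in some order. *)
Definition has_exponent_differences (E : hge) (e : list C) : Prop :=
  exists e', Permutation e e' /\
    Forall2 (fun d d' => d = d' \/ d = - d') (exponent_differences E) e'.

(** * The projective line and its coverings *)

Inductive P1 := Fin (z : C) | Inf.

Definition toC (p : P1) : C := match p with Fin z => z | Inf => 0 end.

Definition P1inv (p : P1) : P1 :=
  match p with
  | Fin z => if Ceq_dec z 0 then Inf else Fin (/ z)
  | Inf => Fin 0
  end.

(* Local parametrization of P1 centred at [p]: t |-> p + t if p is finite, and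
   t |-> 1/t if p is infinite. *)
Definition param (p : P1) (t : C) : P1 :=
  match p with Fin a => Fin (a + t) | Inf => P1inv (Fin t) end.

(* [f] is holomorphic at [p] and takes the value [f p] there with multiplicity
   (ramification index) [m]: in local coordinates, f is t |-> t^m u(t) with u
   holomorphic and u(0) <> 0. *)
Definition ramification (f : P1 -> P1) (p : P1) (m : nat) : Prop :=
  (0 < m)%nat /\
  exists u : C -> C,
    locally (0 : C) (fun t : C => ex_derive u t) /\ u 0 <> 0 /\
    locally (0 : C) (fun t : C => f (param p t) = param (f p) (t ^ m * u t)).

(* Branched covering of degree [d]: a holomorphic map all of whose fibres
   consist of [d] points counted with multiplicity. *)
Definition is_covering (f : P1 -> P1) (d : nat) : Prop :=
  forall q : P1, exists fibre : list (P1 * nat),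
    NoDup (map fst fibre) /\
    (forall p, f p = q <-> In p (map fst fibre)) /\
    List.Forall (fun pm => ramification f (fst pm) (snd pm)) fibre /\
    list_sum (map snd fibre) = d.

(** * Pull-back transformations *)

(* Coefficients in order of increasing degree. *)
Definition Cpeval (p : list C) (x : C) : C :=
  fold_right (fun a v => a + x * v) 0 p.

(* Nonzero rational functions of one variable. *)
Record ratfun := Ratfun {
  rnum : list C;
  rden : list C;
  rnum_neq0 : exists x, Cpeval rnum x <> 0;
  rden_neq0 : exists x, Cpeval rden x <> 0 }.

(* [h] is a holomorphic branch near [x0] of the power r^a; this requires that
   x0 be neither a zero nor a pole of r. *)
Definition power_branch (r : ratfun) (a : C) (x0 : C) (h : C -> C) : Prop :=
  Cpeval (rden r) x0 <> 0 /\
  exists L : C -> C,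
    locally x0 (fun x => ex_derive L x /\
                         Cexp (L x) = Cpeval (rnum r) x / Cpeval (rden r) x /\
                         h x = Cexp (a * L x)).

(* [theta] is a branch near [x0] of the product of the powers r^a, (r, a) in [T]. *)
Fixpoint power_product_branch (T : list (ratfun * C)) (x0 : C)
    (theta : C -> C) : Prop :=
  match T with
  | [] => locally x0 (fun x => theta x = 1)
  | (r, a) :: T' =>
      exists h theta' : C -> C,
        power_branch r a x0 h /\ power_product_branch T' x0 theta' /\
        locally x0 (fun x => theta x = h x * theta' x)
  end.

(* For some product theta of powers of rational functions, the substitution
   Y(x) = theta(x) y(f(x)) turns the equation [E] for y at f(x) into the
   equation [E'] for Y at x.  This is required at all points x0 at which both
   equations are nonsingular and theta has branches, for all of these branches.
   The excluded points are finitely many when f is a covering. *)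
Definition defines_pullback (f : P1 -> P1) (E E' : hge) : Prop :=
  exists T : list (ratfun * C),
    forall (x0 z0 : C) (theta y : C -> C),
      x0 <> 0 -> x0 <> 1 ->
      f (Fin x0) = Fin z0 -> z0 <> 0 -> z0 <> 1 ->
      power_product_branch T x0 theta ->
      twice_derivable y z0 ->
      let Y := fun x : C => theta x * y (toC (f (Fin x))) in
      twice_derivable Y x0 /\
      (satisfies_at E y z0 <-> satisfies_at E' Y x0).

(** * The covering *)

Definition phi5_num (x : C) : C := 4 * Ci * x * (x - 1) * (4 * x - 2 - 11 * Ci) ^ 4.
Definition phi5_den (x : C) : C := (8 * x - 4 + 3 * Ci) ^ 5.
Definition phi5 (x : C) : C := phi5_num x / phi5_den x.

(* The numerator has degree 6, the denominator degree 5, and they have no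
   common zero; so phi5 extends to P1 with infinity mapped to infinity. *)
Definition phi5_P1 (p : P1) : P1 :=
  match p with
  | Fin x => if Ceq_dec (phi5_den x) 0 then Inf else Fin (phi5 x)
  | Inf => Inf
  end.

(* Main.v *)
Require Import Defs.
From Stdlib Require Import Reals List Lra Lia ZArith Permutation FinFun ListDec InitialRing.
From Coquelicot Require Import Coquelicot.
From mathcomp Require all_boot all_algebra complex Rstruct.
Import ListNotations.
Open Scope C_scope.

(** phi5 = 4 i x (x - 1) Q^4 / s^5 with Q, s linear, 1 - phi5 = - i P^2 / s^5 with P a
    separable cubic, and phi5' = 4 i Q^3 P / s^6.  So all ramification lies above 0, 1 and
    infinity, with indices 1, 1, 4; 2, 2, 2; 5, 1, and the fibres are obtained by splitting
    polynomials over the complex numbers.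

    For Y = theta (y o phi) with theta' = l theta, the operator of the second hypergeometric
    equation applied to Y equals theta K times that of the first applied to y, at phi,
    provided that three identities between rational functions hold (coefficients of y'', y'
    and y).  They hold at x = 0 as well, where both sides of each stated identity are thus
    holomorphic solutions of one hypergeometric equation with the same value.  Such solutions
    coincide because the other local exponent 1 - C is smaller than 1 (C > 0): on a ray, the
    equation forces the derivative of the difference to have no positive maximum modulus. *)

(** * Splitting polynomials over the complex numbers *)

(** The parameters and prefactors are dictated by local exponents. The differences 1/4, 1/2, 1/5
    over 0, 1 and infinity, multiplied by the ramification indices 4, 2, 5, become 1 at every
    ramified point; removing the common exponent there by theta makes the point regular, and only
    the unramified points 0, 1 and infinity stay singular. The second identity is the same pull-back
    read in the coordinates 1/x and 1/phi5 around the unramified point infinity, which is why a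
    second set of explicit formulas occurs.

    Comparing Taylor coefficients would first require a power series expansion of theta (y o phi).
    The maximum argument on rays avoids this: two complex derivatives near 0 suffice. Series are
    then needed only for the hypergeometric functions themselves, and only in some small disc, so
    crude geometric bounds on coefficients are enough.

    A general fibre has no explicit points. It is obtained from algebraic closedness, and its
    simplicity from a Wronskian that vanishes only over 0, 1 and infinity. *)

Definition root_product (rs : list C) (x : C) : C :=
  fold_right (fun r v => Cmult (Cminus x r) v) (RtoC 1) rs.

Module FundamentalTheorem.
Import all_boot all_algebra complex Rstruct.
Import GRing.Theory.
Local Open Scope ring_scope.

Definition to_mc (z : Coquelicot.Complex.C) : R[i] := Complex (fst z) (snd z).
Definition of_mc (z : R[i]) : Coquelicot.Complex.C := (complex.Re z, complex.Im z).

Lemma of_mcK z : of_mc (to_mc z) = z. Proof. by case: z. Qed.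
Lemma of_mc_add x y : of_mc (x + y) = Cplus (of_mc x) (of_mc y).
Proof. by case: x; case: y. Qed.

Lemma of_mc_sub x y : of_mc (x - y) = Cminus (of_mc x) (of_mc y).
Proof. by case: x; case: y. Qed.

Lemma of_mc_mul x y : of_mc (x * y) = Cmult (of_mc x) (of_mc y).
Proof. by case: x; case: y. Qed.

Lemma of_mc_horner (p : seq R[i]) x :
  of_mc (horner_rec p x) = Cpeval (map of_mc p) (of_mc x).
Proof.
elim: p => [|a p IH] //=.
by rewrite of_mc_add of_mc_mul IH Cplus_comm Cmult_comm.
Qed.

Lemma of_mc_prod (rs : seq R[i]) x :
  of_mc (\prod_(r <- rs) (x - r)) = root_product (map of_mc rs) (of_mc x).
Proof.
elim: rs => [|r rs IH]; first by rewrite big_nil.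
by rewrite big_cons of_mc_mul of_mc_sub IH.
Qed.

(** Both models of the complex numbers are pairs of reals with the same arithmetic. The closed field
    [R[i]] splits the polynomial, and Horner evaluation and the product of linear factors are read
    back coordinatewise. *)
Lemma Cpeval_roots_seq (p : seq Coquelicot.Complex.C) : last (RtoC 0) p <> RtoC 0 ->
  exists rs, size rs = (size p).-1 /\
    forall x, Cpeval p x = Cmult (last (RtoC 0) p) (root_product rs x).
Proof.
move=> Hp; set q := map to_mc p.
have lastq : last 0 q = to_mc (last (RtoC 0) p) by rewrite -[0]/(to_mc (RtoC 0)) last_map.
have lastq0 : last 0 q != 0.
  by apply/eqP; rewrite lastq => E; apply: Hp; rewrite -[LHS]of_mcK E.
(* [Polynomial] tests the last entry with default 1; on a nonempty list the default does not matter,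
   and the empty list contradicts [lastq0]. *)
have lastq1 : last 1 q != 0 by case: (q) lastq0 => [|a s] //=; rewrite eqxx.
pose P := Polynomial lastq1.
have leadP : lead_coef P = last 0 q by rewrite lead_coefE /= nth_last.
have [rs Prs] := closed_field_poly_normal P.
have szP : size P = size p by rewrite /= size_map.
exists (map of_mc rs); split.
  by rewrite size_map -szP [in RHS]Prs size_scale ?leadP // size_prod_XsubC.
move=> x.
have -> : Cpeval p x = of_mc P.[to_mc x].
  rewrite /horner of_mc_horner of_mcK /= -map_comp map_id_in // => z _; exact: of_mcK.
rewrite Prs hornerZ horner_prod of_mc_mul leadP lastq of_mcK; congr Cmult.
under eq_bigr do rewrite hornerXsubC.
by rewrite of_mc_prod of_mcK.
Qed.

(** Displaying the leading coefficient as a separate last entry makes the degree equal to the length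
    of [p], so for explicit lists the number of roots is found by computation. *)
Lemma Cpeval_roots (p : seq Coquelicot.Complex.C) (c : Coquelicot.Complex.C) :
  c <> RtoC 0 -> exists rs, List.length rs = List.length p /\
    forall x, Cpeval (List.app p [:: c]) x = Cmult c (root_product rs x).
Proof.
move=> c0; rewrite -[List.app _ _]/(p ++ [:: c]).
have [|rs []] := @Cpeval_roots_seq (p ++ [:: c]); rewrite last_cat //=.
by rewrite size_cat addn1 => szrs Hrs; exists rs.
Qed.
End FundamentalTheorem.

(** * Field arithmetic with Gaussian constants *)

(* The coefficient ring Z[i] for [ring] and [field]: the relation Ci * Ci = -1 is then
   decided by computation with coefficients. *)
Definition gauss : Type := Z * Z.
Definition gadd (a b : gauss) : gauss := (fst a + fst b, snd a + snd b)%Z.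
Definition gsub (a b : gauss) : gauss := (fst a - fst b, snd a - snd b)%Z.
Definition gmul (a b : gauss) : gauss :=
  (fst a * fst b - snd a * snd b, fst a * snd b + snd a * fst b)%Z.
Definition gopp (a : gauss) : gauss := (- fst a, - snd a)%Z.
Definition geqb (a b : gauss) : bool :=
  (Z.eqb (fst a) (fst b) && Z.eqb (snd a) (snd b))%bool.
Definition gaussC (a : gauss) : C := (IZR (fst a), IZR (snd a)).

Lemma gauss_morph :
  ring_morph (R := C) 0 1 Cplus Cmult Cminus Copp eq
    (0, 0)%Z (1, 0)%Z gadd gmul gsub gopp geqb gaussC.
Proof.
  constructor; unfold gaussC; try reflexivity.
  - intros [a b] [c d]; unfold gadd; simpl. now rewrite !plus_IZR.
  - intros [a b] [c d]; unfold gsub; simpl. now rewrite !minus_IZR.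
  - intros [a b] [c d]; unfold gmul; simpl.
    now rewrite minus_IZR, plus_IZR, !mult_IZR.
  - intros [a b]; unfold gopp; simpl. now rewrite !opp_IZR.
  - intros [a b] [c d]; unfold geqb; simpl; intros H.
    apply andb_prop in H; destruct H as [H1 H2].
    apply Z.eqb_eq in H1, H2. now subst.
Qed.

(** Together with [gauss_morph] this makes equality of constants decidable in both directions, so
    [field] can discharge the nonvanishing of Gaussian constants in denominators. *)
Lemma gauss_complete x y : gaussC x = gaussC y -> geqb x y = true.
Proof.
  destruct x as [a b], y as [c d]; unfold gaussC, geqb; simpl; intros H.
  injection H; intros H2 H1. apply eq_IZR in H1, H2; subst.
  now rewrite !Z.eqb_refl.
Qed.

Ltac gauss_cst t :=
  lazymatch t with
  | gaussC ?g => g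
  | Ci => constr:((0, 1)%Z)
  | RtoC (IZR ?n) =>
      match isZcst n with
      | true => constr:((n, 0%Z))
      | _ => constr:(InitialRing.NotConstant)
      end
  | _ => constr:(InitialRing.NotConstant)
  end.
Add Field gauss_field : C_field_theory
  (morphism gauss_morph, completeness gauss_complete, constants [gauss_cst],
   power_tac C_power_theory [Rpow_tac]).

(** [field] states side conditions about normalised denominators; each is identified with a
    hypothesis up to a ring identity. *)
Ltac nonzero_by_ring :=
  match goal with
  | |- _ /\ _ => split; nonzero_by_ring
  | H : ?a <> RtoC 0 |- ?b <> RtoC 0 =>
      exact H || (let E := fresh in intros E; apply H; rewrite <- E; ring)
  end.
Ltac gauss_field := field; nonzero_by_ring.

(** * Complex derivatives *)

Lemma locally_C_imp (z : C) (P Q : C -> Prop) : (forall w : C, P w -> Q w) ->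
  locally z P -> locally z Q.
Proof. apply filter_imp. Qed.

(** The balls of the product uniform structure on C are squares; they are compared with discs of the
    modulus at the cost of a factor sqrt 2. *)
Lemma locally_C_Cmod (z : C) (P : C -> Prop) :
  locally z P <->
  exists d : R, (0 < d)%R /\ forall w : C, (Cmod (w - z) < d)%R -> P w.
Proof.
  split.
  - intros [e He]. exists e; split; [apply cond_pos|]. intros w Hw.
    apply He. now apply C_NormedModule_mixin_compat1.
  - intros [d [Hd H]].
    assert (Hp : (0 < d / sqrt 2)%R).
    { apply Rdiv_lt_0_compat; [exact Hd|]. apply sqrt_lt_R0; lra. }
    exists (mkposreal _ Hp). intros w Hw. apply H.
    apply C_NormedModule_mixin_compat2 in Hw. simpl in Hw.
    replace (sqrt 2 * (d / sqrt 2))%R with d in Hw; [exact Hw|].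
    field. apply Rgt_not_eq, sqrt_lt_R0; lra.
Qed.

Lemma is_derive_C_eps (f : C -> C) (z l : C) :
  is_derive f z l <->
  forall e : R, (0 < e)%R -> exists d : R, (0 < d)%R /\
    forall w : C, (Cmod (w - z) < d)%R ->
      (Cmod (f w - f z - (w - z) * l) <= e * Cmod (w - z))%R.
Proof.
  split.
  - intros [_ H] e He.
    specialize (H z (fun P HP => HP) (mkposreal e He)).
    destruct H as [d H]. exists d; split; [apply cond_pos|exact H].
  - intros H. split.
    + apply (is_linear_scal_l (K := C_AbsRing) (V := C_NormedModule)).
    + intros x Hx e.
      assert (x = z) as ->.
      { symmetry. apply (is_filter_lim_locally_unique (K := C_AbsRing) (V := AbsRing_NormedModule C_AbsRing)).
        exact Hx. }
      destruct (H e (cond_pos e)) as [d [Hd H']].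
      exists (mkposreal d Hd). exact H'.
Qed.

Lemma is_derive_C_cont (f : C -> C) (z l : C) : is_derive f z l ->
  forall e : R, (0 < e)%R -> locally z (fun w => (Cmod (f w - f z) < e)%R).
Proof.
  intros H e He. apply locally_C_Cmod.
  destruct (proj1 (is_derive_C_eps f z l) H 1%R Rlt_0_1) as [d [Hd Hw]].
  pose proof (Cmod_ge_0 l).
  assert (Hk : (0 < e / (1 + Cmod l))%R) by (apply Rdiv_lt_0_compat; lra).
  exists (Rmin d (e / (1 + Cmod l))). split; [now apply Rmin_glb_lt|].
  intros w Hd'. specialize (Hw w (Rlt_le_trans _ _ _ Hd' (Rmin_l _ _))).
  assert (Hd2 := Rlt_le_trans _ _ _ Hd' (Rmin_r _ _)).
  replace (f w - f z) with ((f w - f z - (w - z) * l) + (w - z) * l) by ring.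
  eapply Rle_lt_trans; [apply Cmod_triangle|]. rewrite Cmod_mult.
  apply Rle_lt_trans with (Cmod (w - z) * (1 + Cmod l))%R; [lra|].
  apply (Rmult_lt_compat_r (1 + Cmod l)) in Hd2; [|lra].
  replace (e / (1 + Cmod l) * (1 + Cmod l))%R with e in Hd2 by (field; lra). lra.
Qed.

(* [is_derive] differentiates at points of C as a module over itself, whereas the values
   lie in [C_NormedModule]. *)
Lemma is_derive_C_module (f : C -> C) (z l : C) :
  is_derive (V := AbsRing_NormedModule C_AbsRing) f z l <-> is_derive f z l.
Proof.
  split; intros [_ H]; split; try exact H;
    apply (is_linear_scal_l (K := C_AbsRing)).
Qed.

Lemma C_derive_const (c z : C) : is_derive (fun _ : C => c) z (RtoC 0).
Proof. apply (is_derive_const (V := C_NormedModule)). Qed.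

Lemma C_derive_id (z : C) : is_derive (fun w : C => w) z (RtoC 1).
Proof. apply is_derive_C_module, (is_derive_id (K := C_AbsRing)). Qed.

Section Rules.
Variables (f g : C -> C) (z f' g' : C).

Lemma C_derive_eq (l : C) : is_derive f z l -> l = f' -> is_derive f z f'.
Proof. now intros H <-. Qed.

Lemma C_derive_ext_loc : locally z (fun w => f w = g w) ->
  is_derive f z f' -> is_derive g z f'.
Proof.
  intros H. apply is_derive_ext_loc. apply locally_C_Cmod in H.
  destruct H as [d [Hd H]]. exists (mkposreal d Hd). exact H.
Qed.

Lemma C_derive_opp : is_derive f z f' -> is_derive (fun w => - f w) z (- f').
Proof. apply (is_derive_opp (V := C_NormedModule)). Qed.

Lemma C_derive_comp : is_derive f (g z) f' -> is_derive g z g' ->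
  is_derive (fun w => f (g w)) z (g' * f').
Proof.
  intros Hf Hg. apply (is_derive_comp (V := C_NormedModule)); [exact Hf|].
  now apply is_derive_C_module.
Qed.

Hypothesis Hf : is_derive f z f'.
Hypothesis Hg : is_derive g z g'.

Lemma C_derive_plus : is_derive (fun w => f w + g w) z (f' + g').
Proof. exact (is_derive_plus (V := C_NormedModule) f g z f' g' Hf Hg). Qed.

Lemma C_derive_minus : is_derive (fun w => f w - g w) z (f' - g').
Proof. exact (is_derive_minus (V := C_NormedModule) f g z f' g' Hf Hg). Qed.

Lemma C_derive_mult : is_derive (fun w => f w * g w) z (f' * g z + f z * g').
Proof.
  apply is_derive_C_module.
  apply (is_derive_mult (K := C_AbsRing) f g z f' g').
  - now apply is_derive_C_module.
  - now apply is_derive_C_module.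
  - intros; apply Cmult_comm.
Qed.
End Rules.

Lemma C_derive_inv (z : C) : z <> 0 -> is_derive Cinv z (- / (z * z)).
Proof.
  intros Hz. apply is_derive_C_eps. intros e He.
  assert (Hm := proj1 (Cmod_gt_0 z) Hz). set (m := Cmod z) in *.
  (* The first bound keeps |w| above m/2; with the second, the remainder (w - z)^2 / (w z^2) is at
     most e |w - z|. *)
  exists (Rmin (m / 2) (e * m ^ 3 / 2)). split.
  { apply Rmin_glb_lt; [lra|]. apply Rdiv_lt_0_compat; [|lra].
    apply Rmult_lt_0_compat; [exact He|]. now apply pow_lt. }
  intros w Hw.
  assert (H1 := Rlt_le_trans _ _ _ Hw (Rmin_l _ _)).
  assert (H2 := Rlt_le_trans _ _ _ Hw (Rmin_r _ _)).
  assert (Hwm : (m / 2 < Cmod w)%R).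
  { assert (T := Cmod_triangle (z - w) w).
    replace (z - w + w) with z in T by ring.
    replace (z - w) with (- (w - z)) in T by ring. rewrite Cmod_opp in T.
    fold m in T. lra. }
  assert (Hw0 : w <> 0) by (apply Cmod_gt_0; lra).
  replace (/ w - / z - (w - z) * - / (z * z)) with ((w - z) * (w - z) / (w * z ^ 2))
    by (field; auto).
  rewrite Cmod_div by (apply Cmult_neq_0; [|apply Cpow_nz]; auto).
  rewrite !Cmod_mult, Cmod_pow. fold m.
  assert (Hp : (0 < Cmod w * m ^ 2)%R)
    by (apply Rmult_lt_0_compat; [lra|]; apply pow_lt; lra).
  apply (Rmult_le_reg_r (Cmod w * m ^ 2)); [exact Hp|].
  unfold Rdiv at 1. rewrite Rmult_assoc, Rinv_l, Rmult_1_r by lra.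
  rewrite (Rmult_comm e), Rmult_assoc.
  apply Rmult_le_compat_l; [apply Cmod_ge_0|].
  apply Rle_trans with (e * (m / 2 * m ^ 2))%R; [lra|].
  apply Rmult_le_compat_l; [lra|]. apply Rmult_le_compat_r; [apply pow_le; lra|lra].
Qed.

Lemma C_derive_div (f g : C -> C) (z f' g' : C) : g z <> 0 ->
  is_derive f z f' -> is_derive g z g' ->
  is_derive (fun w => f w / g w) z ((f' * g z - f z * g') / (g z * g z)).
Proof.
  intros H0 Hf Hg. eapply C_derive_eq.
  - apply C_derive_mult; [exact Hf|].
    apply (C_derive_comp Cinv g); [now apply C_derive_inv|exact Hg].
  - simpl. field. exact H0.
Qed.

(** The factor is [IZR] of an integer so that for a numeral exponent it computes to a constant
    recognised by [gauss_cst]. *)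
Lemma C_derive_pow (f : C -> C) (z f' : C) (n : nat) : is_derive f z f' ->
  is_derive (fun w => f w ^ S n) z (IZR (Z.of_nat (S n)) * f z ^ n * f').
Proof.
  intros Hf. induction n as [|n IH].
  - apply (C_derive_ext_loc f).
    + apply locally_C_Cmod; exists 1%R; split; [lra|]; intros; simpl; ring.
    + eapply C_derive_eq; [exact Hf|]. simpl. ring.
  - eapply C_derive_eq; [exact (C_derive_mult _ _ _ _ _ Hf IH)|].
    rewrite (Nat2Z.inj_succ (S n)), succ_IZR, RtoC_plus. cbn [Cpow]. ring.
Qed.

Ltac C_derive_step :=
  lazymatch goal with
  | |- is_derive (fun _ => ?c) _ _ => apply C_derive_const
  | |- is_derive (fun w => w) _ _ => apply C_derive_id
  | |- is_derive (fun w => @?a w + @?b w) _ _ => eapply (C_derive_plus a b); C_derive_step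
  | |- is_derive (fun w => @?a w - @?b w) _ _ => eapply (C_derive_minus a b); C_derive_step
  | |- is_derive (fun w => - @?a w) _ _ => eapply (C_derive_opp a); C_derive_step
  | |- is_derive (fun w => @?a w * @?b w) _ _ => eapply (C_derive_mult a b); C_derive_step
  | |- is_derive (fun w => @?a w / @?b w) _ _ => eapply (C_derive_div a b); [|C_derive_step|C_derive_step]
  | |- is_derive (fun w => @?a w ^ (S ?n)) _ _ => eapply (fun z l => C_derive_pow a z l n); C_derive_step
  | |- _ => eassumption
  end.
Ltac C_derive := eapply C_derive_eq; [C_derive_step|].

(** * Pull-back of hypergeometric operators *)

(** Both derivatives are explicit functions near the point, so that they can be handled as formulas;
    [C_derive] enters only in the passage from and to [twice_derivable]. *)
Definition jet2 (f f1 f2 : C -> C) (z : C) : Prop :=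
  locally z (fun w => is_derive f w (f1 w) /\ is_derive f1 w (f2 w)).

Lemma jet2_ext (f g f1 f2 : C -> C) (z : C) :
  locally z (fun w => f w = g w) -> jet2 f f1 f2 z -> jet2 g f1 f2 z.
Proof.
  unfold jet2. intros H1 H2. apply locally_locally in H1.
  generalize (filter_and _ _ H1 H2). apply filter_imp.
  intros w [Hw [Ha Hb]]. split; [|exact Hb]. now apply (C_derive_ext_loc f).
Qed.

Lemma twice_derivable_jet2 (y : C -> C) (z : C) :
  twice_derivable y z -> jet2 y (C_derive y) (C_derive (C_derive y)) z.
Proof.
  unfold twice_derivable, jet2. apply filter_imp. intros w [H1 H2].
  split; apply C_derive_correct; auto; exact (RtoC 0).
Qed.

Lemma jet2_C_derive (f f1 f2 : C -> C) (z : C) : jet2 f f1 f2 z ->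
  twice_derivable f z /\ C_derive f z = f1 z /\ C_derive (C_derive f) z = f2 z.
Proof.
  unfold jet2, twice_derivable. intros H.
  assert (H1 : locally z (fun w => is_derive (C_derive f) w (f2 w))).
  { assert (H' := locally_locally _ _ H). generalize (filter_and _ _ H' H).
    apply filter_imp. intros w [Hw [_ Hb]]. apply (C_derive_ext_loc f1); [|exact Hb].
    revert Hw. apply filter_imp. intros v [Hv _]. symmetry.
    now apply is_C_derive_unique. }
  split; [|split].
  - generalize (filter_and _ _ H H1). apply filter_imp. intros w [[Ha _] Hb].
    split; eexists; eassumption.
  - apply is_C_derive_unique. now apply locally_singleton in H.
  - apply is_C_derive_unique. now apply locally_singleton in H1.
Qed.

Definition ode (E : hge) (z y y1 y2 : C) : C :=
  z * (1 - z) * y2 + (hgC E - (hgA E + hgB E + 1) * z) * y1 - hgA E * hgB E * y.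

(* [l], [l1] are the logarithmic derivative of theta and its derivative; [z], [z1], [z2]
   the value of the covering and its derivatives. *)
Definition pullback_relations (E E' : hge) (K x z z1 z2 l l1 : C) : Prop :=
  x * (1 - x) * (z1 * z1) = K * (z * (1 - z)) /\
  x * (1 - x) * (2 * l * z1 + z2) + (hgC E' - (hgA E' + hgB E' + 1) * x) * z1
    = K * (hgC E - (hgA E + hgB E + 1) * z) /\
  x * (1 - x) * (l * l + l1) + (hgC E' - (hgA E' + hgB E' + 1) * x) * l
    - hgA E' * hgB E' = - (K * (hgA E * hgB E)).

Lemma ode_pullback (E E' : hge) (K x z z1 z2 l l1 t y y1 y2 : C) :
  pullback_relations E E' K x z z1 z2 l l1 ->
  ode E' x (t * y) (t * (l * y + z1 * y1))
    (t * ((l * l + l1) * y + (2 * l * z1 + z2) * y1 + z1 * z1 * y2))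
  = t * K * ode E z y y1 y2.
Proof.
  intros (H2 & H1 & H0). unfold ode.
  transitivity (t * (x * (1 - x) * (z1 * z1) * y2
    + (x * (1 - x) * (2 * l * z1 + z2) + (hgC E' - (hgA E' + hgB E' + 1) * x) * z1) * y1
    + (x * (1 - x) * (l * l + l1) + (hgC E' - (hgA E' + hgB E' + 1) * x) * l
        - hgA E' * hgB E') * y)); [ring|].
  rewrite H2, H1, H0. ring.
Qed.

Lemma jet2_pullback (t l l1 f f1 f2 y y1 y2 : C -> C) (x : C) :
  locally x (fun w => is_derive t w (t w * l w) /\ is_derive l w (l1 w)) ->
  jet2 f f1 f2 x -> jet2 y y1 y2 (f x) ->
  jet2 (fun w => t w * y (f w))
    (fun w => t w * (l w * y (f w) + f1 w * y1 (f w)))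
    (fun w => t w * ((l w * l w + l1 w) * y (f w)
      + (2 * l w * f1 w + f2 w) * y1 (f w) + f1 w * f1 w * y2 (f w))) x.
Proof.
  unfold jet2. intros Ht Hf Hy.
  assert (Hy' : locally x (fun w => is_derive y (f w) (y1 (f w)) /\
                                    is_derive y1 (f w) (y2 (f w)))).
  { apply locally_C_Cmod in Hy. destruct Hy as [d [Hd Hy]].
    assert (Hf0 := locally_singleton _ _ Hf). destruct Hf0 as [Hf0 _].
    generalize (is_derive_C_cont _ _ _ Hf0 d Hd). apply filter_imp.
    intros w Hw. now apply Hy. }
  generalize (filter_and _ _ Ht (filter_and _ _ Hf Hy')). apply filter_imp.
  intros w ((Ht1 & Hl) & (Hf1 & Hf2) & Hy1 & Hy2).
  assert (Da := C_derive_comp y f w _ _ Hy1 Hf1).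
  assert (Db := C_derive_comp y1 f w _ _ Hy2 Hf1).
  split.
  - eapply C_derive_eq; [exact (C_derive_mult _ _ _ _ _ Ht1 Da)|]. cbv beta; ring.
  - eapply C_derive_eq.
    + apply (C_derive_mult t); [exact Ht1|].
      apply (C_derive_plus (fun w => l w * y (f w)) (fun w => f1 w * y1 (f w))).
      * exact (C_derive_mult _ _ _ _ _ Hl Da).
      * exact (C_derive_mult _ _ _ _ _ Hf2 Db).
    + cbv beta; ring.
Qed.

(** * Complex exponential and logarithm *)

Lemma Cexp_plus (a b : C) : Cexp (a + b) = Cexp a * Cexp b.
Proof.
  destruct a as [a1 a2], b as [b1 b2]. unfold Cexp, Cmult; simpl. rewrite exp_plus, cos_plus, sin_plus.
  f_equal; ring.
Qed.

Lemma Cexp_0 : Cexp 0 = 1.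
Proof. unfold Cexp; simpl. rewrite exp_0, cos_0, sin_0. unfold RtoC. f_equal; ring. Qed.

Lemma Cexp_neq_0 (a : C) : Cexp a <> 0.
Proof.
  intros H. apply C1_nz. rewrite <- Cexp_0. replace (RtoC 0) with (a + - a) by ring.
  rewrite Cexp_plus, H. ring.
Qed.

Lemma derivable_pt_lim_eps (f : R -> R) (l : R) : derivable_pt_lim f 0 l ->
  forall e : R, (0 < e)%R -> exists d : R, (0 < d)%R /\
    forall h : R, (Rabs h < d)%R -> (Rabs (f h - f 0 - l * h) <= e * Rabs h)%R.
Proof.
  intros H e He. destruct (H e He) as [d Hd]. exists d; split; [apply cond_pos|].
  intros h Hh. destruct (Req_dec h 0) as [->|Hn].
  - rewrite Rmult_0_r, !Rminus_diag, Rabs_R0. lra.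
  - specialize (Hd h Hn Hh). rewrite Rplus_0_l in Hd.
    replace (f h - f 0 - l * h)%R with (((f h - f 0) / h - l) * h)%R by (field; auto).
    rewrite Rabs_mult. apply Rmult_le_compat_r; [apply Rabs_pos|lra].
Qed.

Lemma Cmod_le_Re_Im (z : C) : (Cmod z <= Rabs (Re z) + Rabs (Im z))%R.
Proof.
  destruct z as [a b]; simpl. replace (a, b) with (RtoC a + Ci * RtoC b).
  - eapply Rle_trans; [apply Cmod_triangle|].
    rewrite Cmod_mult, Cmod_Ci, !Cmod_R. lra.
  - unfold Cplus, Cmult, Ci, RtoC; simpl. f_equal; ring.
Qed.

Lemma im_le_Cmod (z : C) : (Rabs (Im z) <= Cmod z)%R.
Proof. eapply Rle_trans; [apply Rmax_r|apply Rmax_Cmod]. Qed.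

(** This is complex differentiability of the exponential at 0, from the real derivatives of exp, sin
    and cos; the addition theorem carries it to every point. *)
Lemma Cexp_expansion (e : R) : (0 < e)%R -> exists d : R, (0 < d)%R /\
  forall h : C, (Cmod h < d)%R -> (Cmod (Cexp h - 1 - h) <= e * Cmod h)%R.
Proof.
  (* The two parts of the remainder are bounded by 3 k m and 5 k m with m = |h|, whence e / 8. The
     bound k <= 1 gives |sin v| <= 2 m and |exp u - 1| <= 2 m, and m < k turns their product into a
     multiple of k m. *)
  intros He. set (k := Rmin 1 (e / 8)).
  assert (Hk : (0 < k)%R) by (apply Rmin_glb_lt; lra).
  assert (Hk1 : (k <= 1)%R) by apply Rmin_l.
  assert (Hk2 : (k <= e / 8)%R) by apply Rmin_r.
  destruct (derivable_pt_lim_eps exp _ (derivable_pt_lim_exp 0) k Hk) as [d1 [Hd1 H1]].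
  destruct (derivable_pt_lim_eps sin _ (derivable_pt_lim_sin 0) k Hk) as [d2 [Hd2 H2]].
  destruct (derivable_pt_lim_eps cos _ (derivable_pt_lim_cos 0) k Hk) as [d3 [Hd3 H3]].
  rewrite exp_0 in H1. rewrite sin_0, cos_0 in H2. rewrite cos_0, sin_0 in H3.
  exists (Rmin (Rmin d1 d2) (Rmin d3 k)). split; [repeat apply Rmin_glb_lt; lra|].
  intros [u v] Hh.
  assert (Hc1 := Rlt_le_trans _ _ _ Hh (Rmin_l _ _)).
  assert (Hc2 := Rlt_le_trans _ _ _ Hh (Rmin_r _ _)).
  assert (Ha := Rlt_le_trans _ _ _ Hc1 (Rmin_l _ _)).
  assert (Hb := Rlt_le_trans _ _ _ Hc1 (Rmin_r _ _)).
  assert (Hc := Rlt_le_trans _ _ _ Hc2 (Rmin_l _ _)).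
  assert (Hd := Rlt_le_trans _ _ _ Hc2 (Rmin_r _ _)).
  set (m := Cmod (u, v)) in *.
  assert (Hu : (Rabs u <= m)%R) by apply (re_le_Cmod (u, v)).
  assert (Hv : (Rabs v <= m)%R) by apply (im_le_Cmod (u, v)).
  assert (E1 : (Rabs (exp u - 1 - u) <= k * m)%R).
  { specialize (H1 u (Rle_lt_trans _ _ _ Hu Ha)). rewrite Rmult_1_l in H1.
    eapply Rle_trans; [exact H1|]. apply Rmult_le_compat_l; lra. }
  assert (E2 : (Rabs (sin v - v) <= k * m)%R).
  { specialize (H2 v (Rle_lt_trans _ _ _ Hv Hb)).
    replace (sin v - 0 - 1 * v)%R with (sin v - v)%R in H2 by ring.
    eapply Rle_trans; [exact H2|]. apply Rmult_le_compat_l; lra. }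
  assert (E3 : (Rabs (cos v - 1) <= k * m)%R).
  { specialize (H3 v (Rle_lt_trans _ _ _ Hv Hc)).
    replace (cos v - 1 - - 0 * v)%R with (cos v - 1)%R in H3 by ring.
    eapply Rle_trans; [exact H3|]. apply Rmult_le_compat_l; lra. }
  assert (Hm : (0 <= m)%R) by apply Cmod_ge_0.
  assert (Hcos : (Rabs (cos v) <= 1)%R) by (apply Rabs_le; destruct (COS_bound v); lra).
  assert (Hsin : (Rabs (sin v) <= 2 * m)%R).
  { replace (sin v) with ((sin v - v) + v)%R by ring.
    eapply Rle_trans; [apply Rabs_triang|]. nra. }
  assert (Hexp : (Rabs (exp u - 1) <= 2 * m)%R).
  { replace (exp u - 1)%R with ((exp u - 1 - u) + u)%R by ring.
    eapply Rle_trans; [apply Rabs_triang|]. nra. }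
  assert (Hu1 : (Rabs (1 + u) <= 2)%R).
  { eapply Rle_trans; [apply Rabs_triang|]. rewrite Rabs_R1. lra. }
  eapply Rle_trans; [apply Cmod_le_Re_Im|].
  replace (Re (Cexp (u, v) - 1 - (u, v)))
    with ((exp u - 1 - u) * cos v + (1 + u) * (cos v - 1))%R
    by (unfold Cexp; simpl; ring).
  replace (Im (Cexp (u, v) - 1 - (u, v)))
    with ((exp u - 1) * sin v + (sin v - v))%R by (unfold Cexp; simpl; ring).
  assert (F1 : (Rabs ((exp u - 1 - u) * cos v + (1 + u) * (cos v - 1)) <= 3 * k * m)%R).
  { eapply Rle_trans; [apply Rabs_triang|]. rewrite !Rabs_mult.
    assert (Rabs (exp u - 1 - u) * Rabs (cos v) <= k * m * 1)%R
      by (apply Rmult_le_compat; auto using Rabs_pos).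
    assert (Rabs (1 + u) * Rabs (cos v - 1) <= 2 * (k * m))%R
      by (apply Rmult_le_compat; auto using Rabs_pos).
    lra. }
  assert (F2 : (Rabs ((exp u - 1) * sin v + (sin v - v)) <= 5 * k * m)%R).
  { eapply Rle_trans; [apply Rabs_triang|]. rewrite Rabs_mult.
    assert (Rabs (exp u - 1) * Rabs (sin v) <= 2 * m * (2 * m))%R
      by (apply Rmult_le_compat; auto using Rabs_pos).
    assert (m * m <= k * m)%R by (apply Rmult_le_compat_r; lra).
    lra. }
  assert (k * m <= e / 8 * m)%R by (apply Rmult_le_compat_r; lra). lra.
Qed.

Lemma C_derive_exp (z : C) : is_derive Cexp z (Cexp z).
Proof.
  apply is_derive_C_eps. intros e He.
  assert (Hm := proj1 (Cmod_gt_0 _) (Cexp_neq_0 z)).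
  destruct (Cexp_expansion (e / Cmod (Cexp z))) as [d [Hd H]];
    [now apply Rdiv_lt_0_compat|].
  exists d; split; [exact Hd|]. intros w Hw.
  replace (Cexp w) with (Cexp z * Cexp (w - z))
    by (rewrite <- Cexp_plus; f_equal; ring).
  replace (Cexp z * Cexp (w - z) - Cexp z - (w - z) * Cexp z)
    with (Cexp z * (Cexp (w - z) - 1 - (w - z))) by ring.
  rewrite Cmod_mult. specialize (H _ Hw).
  apply (Rmult_le_compat_l (Cmod (Cexp z))) in H; [|lra].
  eapply Rle_trans; [exact H|]. apply Req_le. field. lra.
Qed.

Lemma Cmod_sqr (z : C) : (Cmod z * Cmod z = Re z * Re z + Im z * Im z)%R.
Proof. pose proof (Cmod2_alt z). simpl in H. lra. Qed.

Lemma Re_div_Cmod_bound (z : C) : z <> 0 -> (-1 <= Re z / Cmod z <= 1)%R.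
Proof.
  intros Hz. assert (Hm := proj1 (Cmod_gt_0 z) Hz).
  apply Rabs_le_between. unfold Rdiv. rewrite Rabs_mult, Rabs_inv.
  rewrite (Rabs_pos_eq (Cmod z)) by lra.
  apply (Rmult_le_reg_r (Cmod z)); [exact Hm|].
  rewrite Rmult_assoc, Rinv_l, Rmult_1_l, Rmult_1_r by lra. apply re_le_Cmod.
Qed.

Lemma sqrt_sin_arg (z : C) : z <> 0 ->
  sqrt (1 - Rsqr (Re z / Cmod z)) = (Rabs (Im z) / Cmod z)%R.
Proof.
  intros Hz. assert (Hm := proj1 (Cmod_gt_0 z) Hz).
  assert (Hs := Cmod_sqr z).
  replace (1 - Rsqr (Re z / Cmod z))%R with (Rsqr (Rabs (Im z) / Cmod z)).
  - apply sqrt_Rsqr. apply Rdiv_le_0_compat; [apply Rabs_pos|exact Hm].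
  - rewrite Rsqr_div'. rewrite <- Rsqr_abs. unfold Rsqr, Rdiv.
    rewrite Rinv_mult. apply (Rmult_eq_reg_r (Cmod z * Cmod z)); [|nra].
    field_simplify; [|lra|lra]. lra.
Qed.

Lemma Cexp_Clog (z : C) : z <> 0 -> Cexp (Clog z) = z.
Proof.
  intros Hz. assert (Hm := proj1 (Cmod_gt_0 z) Hz).
  assert (Hb := Re_div_Cmod_bound z Hz). assert (Hs := sqrt_sin_arg z Hz).
  unfold Cexp, Clog, Carg; simpl. rewrite exp_ln by exact Hm.
  destruct z as [a b]; simpl in *.
  destruct (Rle_dec 0 b) as [Hb0|Hb0].
  - rewrite cos_acos, sin_acos, Hs, Rabs_pos_eq by assumption. f_equal; field; lra.
  - rewrite cos_neg, sin_neg, cos_acos, sin_acos, Hs, Rabs_left by (assumption || lra).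
    f_equal; field; lra.
Qed.

(** The case distinction of [Carg] lies on the real axis; on the right half-plane the arctangent is
    a single formula across it, which gives continuity. *)
Lemma Carg_atan (z : C) : (0 < Re z)%R -> Carg z = atan (Im z / Re z).
Proof.
  intros Hr. assert (Hz : z <> 0) by (intros ->; simpl in Hr; lra).
  assert (Hm := proj1 (Cmod_gt_0 z) Hz).
  assert (E : acos (Re z / Cmod z) = atan (Rabs (Im z) / Re z)).
  { rewrite acos_atan by (now apply Rdiv_lt_0_compat).
    rewrite sqrt_sin_arg by exact Hz. f_equal. field. lra. }
  unfold Carg. rewrite E. destruct (Rle_dec 0 (Im z)) as [H|H].
  - now rewrite Rabs_pos_eq.
  - rewrite Rabs_left, <- atan_opp by lra. f_equal. field. lra.
Qed.

Lemma continuous_R_eps (f : C -> R) (z : C) : continuous (T := C_UniformSpace) f z ->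
  forall e : R, (0 < e)%R -> locally z (fun w => (Rabs (f w - f z) < e)%R).
Proof.
  intros H e He. apply (H (fun y => (Rabs (y - f z) < e)%R)).
  exists (mkposreal e He). intros y Hy. exact Hy.
Qed.

Lemma Re_pos_open (z : C) : (0 < Re z)%R -> locally z (fun w => (0 < Re w)%R).
Proof.
  intros H. apply locally_C_Cmod. exists (Re z). split; [exact H|]. intros w Hw.
  assert (T := Rle_lt_trans _ _ _ (re_le_Cmod (w - z)) Hw).
  apply Rabs_lt_between in T. destruct w, z; simpl in *. lra.
Qed.

Lemma Clog_cont (z : C) : (0 < Re z)%R ->
  forall e : R, (0 < e)%R -> locally z (fun w => (Cmod (Clog w - Clog z) < e)%R).
Proof.
  intros Hr e He.
  assert (Hz : z <> 0) by (intros ->; simpl in Hr; lra).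
  assert (Hm := proj1 (Cmod_gt_0 z) Hz).
  assert (Cre : continuous (T := C_UniformSpace) (U := R_UniformSpace) Re z)
    by (destruct z; apply (continuous_fst (U := R_UniformSpace) (V := R_UniformSpace))).
  assert (Cim : continuous (T := C_UniformSpace) (U := R_UniformSpace) Im z)
    by (destruct z; apply (continuous_snd (U := R_UniformSpace) (V := R_UniformSpace))).
  assert (C1 : continuous (T := C_UniformSpace) (U := R_UniformSpace)
            (fun w : C => atan (Im w * / Re w)) z).
  { apply (continuous_comp (V := R_UniformSpace) (fun w : C => (Im w * / Re w)%R) atan).
    - apply (continuous_mult (K := R_AbsRing) (fun w : C => Im w) (fun w : C => / Re w)%R).
      + exact Cim.
      + apply (continuous_comp (V := R_UniformSpace) Re Rinv); [exact Cre|].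
        apply continuous_Rinv; lra.
    - apply continuity_pt_filterlim, derivable_continuous_pt, derivable_pt_atan. }
  assert (C2 : continuous (T := C_UniformSpace) (U := R_UniformSpace)
            (fun w : C => ln (Cmod w)) z).
  { apply (continuous_comp (V := R_UniformSpace) Cmod ln).
    - intros P [d Hd]. apply locally_C_Cmod. exists d. split; [apply cond_pos|].
      intros w Hw. apply Hd. eapply Rle_lt_trans; [|exact Hw].
      apply Rabs_le. unfold minus, plus, opp; simpl.
      assert (T1 := Cmod_triangle (w - z) z). assert (T2 := Cmod_triangle (z - w) w).
      replace (w - z + z) with w in T1 by ring. replace (z - w + w) with z in T2 by ring.
      replace (z - w) with (- (w - z)) in T2 by ring. rewrite Cmod_opp in T2. lra.
    - apply continuity_pt_filterlim, derivable_continuous_pt.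
      exists (/ Cmod z)%R. now apply derivable_pt_lim_ln. }
  assert (He2 : (0 < e / 2)%R) by lra.
  generalize (filter_and _ _ (Re_pos_open z Hr) (filter_and _ _
    (continuous_R_eps _ _ C1 _ He2) (continuous_R_eps _ _ C2 _ He2))).
  apply filter_imp. intros w (Hw & H1 & H2).
  eapply Rle_lt_trans; [apply Cmod_le_Re_Im|].
  change (Re (Clog w - Clog z)) with (ln (Cmod w) - ln (Cmod z))%R.
  change (Im (Clog w - Clog z)) with (Carg w - Carg z)%R.
  rewrite !Carg_atan by assumption. unfold Rdiv. lra.
Qed.

(* Inverse function argument: [Clog] is a continuous right inverse of [Cexp]. *)
Lemma C_derive_log (z : C) : (0 < Re z)%R -> is_derive Clog z (/ z).
Proof.
  intros Hr.
  assert (Hz : z <> 0) by (intros ->; simpl in Hr; lra).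
  assert (Hm := proj1 (Cmod_gt_0 z) Hz).
  apply is_derive_C_eps. intros e He.
  (* The bound 1/2 absorbs the error term, so that |h| <= 2 |(w - z) / z|; the other bound then
     makes the remainder at most e |w - z|. *)
  set (k := Rmin (1 / 2) (e * Cmod z / 2)).
  assert (Hk : (0 < k)%R).
  { apply Rmin_glb_lt; [lra|]. apply Rdiv_lt_0_compat; [|lra]. now apply Rmult_lt_0_compat. }
  assert (Hk1 : (k <= 1 / 2)%R) by apply Rmin_l.
  assert (Hk2 : (k <= e * Cmod z / 2)%R) by apply Rmin_r.
  destruct (Cexp_expansion k Hk) as [d [Hd H]].
  assert (HL := filter_and _ _ (Re_pos_open z Hr) (Clog_cont z Hr d Hd)).
  apply locally_C_Cmod in HL. destruct HL as [d' [Hd' HL]].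
  exists d'; split; [exact Hd'|]. intros w Hw. destruct (HL w Hw) as [Hwr Hwd].
  assert (Hw0 : w <> 0) by (intros ->; simpl in Hwr; lra).
  set (h := Clog w - Clog z) in *. specialize (H h Hwd).
  assert (E : Cexp h - 1 = (w - z) / z).
  { assert (E1 : Cexp (Clog w) = Cexp h * Cexp (Clog z))
      by (rewrite <- Cexp_plus; f_equal; unfold h; ring).
    rewrite !Cexp_Clog in E1 by assumption. rewrite E1. field. exact Hz. }
  rewrite E in H.
  assert (Hq : Cmod ((w - z) / z) = (Cmod (w - z) / Cmod z)%R) by now apply Cmod_div.
  assert (Hh : (Cmod h <= 2 * (Cmod (w - z) / Cmod z))%R).
  { assert (T := Cmod_triangle ((w - z) / z) (- ((w - z) / z - h))).
    replace ((w - z) / z + - ((w - z) / z - h)) with h in T by ring.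
    rewrite Cmod_opp, Hq in T. pose proof (Cmod_ge_0 h).
    assert (k * Cmod h <= 1 / 2 * Cmod h)%R by (apply Rmult_le_compat_r; lra). lra. }
  replace (h - (w - z) * / z) with (- ((w - z) / z - h)) by (unfold Cdiv; ring).
  rewrite Cmod_opp. eapply Rle_trans; [exact H|].
  apply Rle_trans with (k * (2 * (Cmod (w - z) / Cmod z)))%R.
  { apply Rmult_le_compat_l; lra. }
  apply Rle_trans with (e * Cmod z / 2 * (2 * (Cmod (w - z) / Cmod z)))%R.
  { apply Rmult_le_compat_r; [|lra]. pose proof (Cmod_ge_0 (w - z)).
    apply Rmult_le_pos; [lra|]. now apply Rdiv_le_0_compat. }
  apply Req_le. field. lra.
Qed.

(** * Uniqueness of the holomorphic solution at 0 *)

Lemma derivable_pt_lim_ray_Re (f : C -> C) (w l : C) (t : R) :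
  is_derive f (t * w) l ->
  derivable_pt_lim (fun s : R => Re (f (s * w))) t (Re (w * l)).
Proof.
  intros Hf e He. pose proof (Cmod_ge_0 w) as Hw.
  assert (Hk : (0 < e / (2 * (1 + Cmod w)))%R) by (apply Rdiv_lt_0_compat; lra).
  destruct (proj1 (is_derive_C_eps _ _ _) Hf _ Hk) as [d [Hd H]].
  assert (Hd' : (0 < d / (1 + Cmod w))%R) by (apply Rdiv_lt_0_compat; lra).
  exists (mkposreal _ Hd'). cbn [pos]. intros h Hh0 Hh.
  assert (Eh : Cmod ((t + h)%R * w - t * w) = (Rabs h * Cmod w)%R).
  { rewrite <- Cmod_R, <- Cmod_mult. f_equal. rewrite RtoC_plus. ring. }
  assert (Hah : (0 < Rabs h)%R) by now apply Rabs_pos_lt.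
  assert (Hlt : (Rabs h * (1 + Cmod w) < d)%R).
  { apply (Rmult_lt_compat_r (1 + Cmod w)) in Hh; [|lra].
    replace (d / (1 + Cmod w) * (1 + Cmod w))%R with d in Hh by (field; lra). exact Hh. }
  assert (Hd2 : (Cmod ((t + h)%R * w - t * w) < d)%R) by (rewrite Eh; lra).
  specialize (H _ Hd2). rewrite Eh in H.
  set (D := f ((t + h)%R * w) - f (t * w) - ((t + h)%R * w - t * w) * l) in H.
  assert (HD : (Re (f ((t + h)%R * w)%C) - Re (f (t * w)%C) - h * Re (w * l)%C = Re D)%R).
  { unfold D. generalize (f ((t + h)%R * w)) (f (t * w)). intros a b.
    rewrite RtoC_plus. destruct a, b, w, l; simpl; ring. }
  replace ((Re (f ((t + h)%R * w)%C) - Re (f (t * w)%C)) / h - Re (w * l)%C)%R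
    with (Re D / h)%R by (rewrite <- HD; field; exact Hh0).
  unfold Rdiv. rewrite Rabs_mult, Rabs_inv.
  apply (Rmult_lt_reg_r (Rabs h)); [exact Hah|].
  rewrite Rmult_assoc, Rinv_l, Rmult_1_r by lra.
  eapply Rle_lt_trans; [apply re_le_Cmod|]. eapply Rle_lt_trans; [exact H|].
  apply Rle_lt_trans with (e / (2 * (1 + Cmod w)) * (Rabs h * (1 + Cmod w)))%R.
  { apply Rmult_le_compat_l; lra. }
  replace (e / (2 * (1 + Cmod w)) * (Rabs h * (1 + Cmod w)))%R with (e * Rabs h / 2)%R
    by (field; lra). nra.
Qed.

Lemma derivable_pt_lim_ray_Im (f : C -> C) (w l : C) (t : R) :
  is_derive f (t * w) l ->
  derivable_pt_lim (fun s : R => Im (f (s * w))) t (Im (w * l)).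
Proof.
  intros Hf.
  (* The imaginary part of f is the real part of -i f. *)
  assert (H : is_derive (fun z => - Ci * f z) (t * w) (0 * f (t * w) + - Ci * l)).
  { apply (C_derive_mult (fun _ => - Ci) f); [apply C_derive_const|exact Hf]. }
  apply derivable_pt_lim_ray_Re in H.
  replace (Im (w * l)) with (Re (w * (0 * f (t * w) + - Ci * l)))
    by (generalize (f (t * w)); intros a; unfold Ci; destruct w, l, a; simpl; ring).
  eapply derivable_pt_lim_ext; [|exact H].
  intros s. unfold Ci. destruct (f (s * w)); simpl; ring.
Qed.

(** Only points to the left of t are compared, because a maximum on [0, 1] may be attained at the
    endpoint 1. *)
Lemma derivable_pt_lim_max_left (f : R -> R) (t l : R) : (0 < t)%R ->
  derivable_pt_lim f t l -> (forall s, (0 <= s <= t)%R -> (f s <= f t)%R) -> (0 <= l)%R.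
Proof.
  intros Ht H Hmax. apply Rnot_lt_le. intros Hl.
  destruct (H (- l / 2)%R ltac:(lra)) as [[d Hd] Hh]. simpl in Hh.
  set (h := (- Rmin (d / 2) t)%R).
  assert (Hm : (0 < Rmin (d / 2) t)%R) by (apply Rmin_glb_lt; lra).
  assert (Hm1 := Rmin_l (d / 2) t). assert (Hm2 := Rmin_r (d / 2) t).
  assert (Hh0 : (h <> 0)%R) by (unfold h; lra).
  assert (Hhd : (Rabs h < d)%R) by (unfold h; rewrite Rabs_Ropp, Rabs_pos_eq; lra).
  specialize (Hh h Hh0 Hhd). apply Rabs_lt_between in Hh.
  assert (Hf := Hmax (t + h)%R ltac:(unfold h; lra)).
  assert (0 <= (f (t + h) - f t) / h)%R; [|lra].
  replace ((f (t + h) - f t) / h)%R with ((f t - f (t + h)) / - h)%R by (field; exact Hh0).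
  apply Rdiv_le_0_compat; unfold h in *; lra.
Qed.

(** The mean value theorem holds for real functions only; applying it to the real and the imaginary
    part costs the factor 2. *)
Lemma Cmod_ray_bound (f f1 : C -> C) (w : C) (M t : R) :
  (forall s : R, (0 <= s <= 1)%R -> is_derive f (s * w) (f1 (s * w))) ->
  (forall s : R, (0 <= s <= 1)%R -> (Cmod (f1 (s * w)%C) <= M)%R) ->
  (0 <= t <= 1)%R -> (Cmod (f (t * w) - f 0)%C <= 2 * Cmod w * M)%R.
Proof.
  intros Hf HM Ht.
  assert (HM0 : (0 <= M)%R).
  { eapply Rle_trans; [apply Cmod_ge_0|apply (HM 0%R); lra]. }
  assert (B : forall s : R, (0 <= s <= 1)%R -> (Cmod (w * f1 (s * w))%C <= Cmod w * M)%R).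
  { intros s Hs. rewrite Cmod_mult. apply Rmult_le_compat_l; [apply Cmod_ge_0|auto]. }
  assert (HB : (0 <= Cmod w * M)%R) by (apply Rmult_le_pos; [apply Cmod_ge_0|exact HM0]).
  assert (mvt : forall p p1 : R -> R,
    (forall s, (0 <= s <= 1)%R -> derivable_pt_lim p s (p1 s)) ->
    (forall s, (0 <= s <= 1)%R -> (Rabs (p1 s) <= Cmod w * M)%R) ->
    (Rabs (p t - p 0%R) <= Cmod w * M)%R).
  { intros p p1 Hp Hb. destruct (Req_dec t 0) as [->|Ht0].
    { now rewrite Rminus_diag, Rabs_R0. }
    destruct (MVT_cor2 p p1 0 t) as [s [Es Hs]]; [lra|intros; apply Hp; lra|].
    rewrite Es, Rabs_mult, Rminus_0_r, (Rabs_pos_eq t) by lra.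
    specialize (Hb s ltac:(lra)). pose proof (Rabs_pos (p1 s)). nra. }
  replace (f 0) with (f (0%R * w)) by (f_equal; ring).
  eapply Rle_trans; [apply Cmod_le_Re_Im|].
  change (Re (f (t * w) - f (0%R * w))) with (Re (f (t * w)%C) - Re (f (0%R * w)%C))%R.
  change (Im (f (t * w) - f (0%R * w))) with (Im (f (t * w)%C) - Im (f (0%R * w)%C))%R.
  assert (H1 := mvt (fun s => Re (f (s * w))) (fun s => Re (w * f1 (s * w)))).
  assert (H2 := mvt (fun s => Im (f (s * w))) (fun s => Im (w * f1 (s * w)))).
  cbv beta in H1, H2.
  assert (Rabs (Re (f (t * w)%C) - Re (f (0%R * w)%C)) <= Cmod w * M)%R.
  { apply H1; intros s Hs; [now apply derivable_pt_lim_ray_Re, Hf|].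
    eapply Rle_trans; [apply re_le_Cmod|now apply B]. }
  assert (Rabs (Im (f (t * w)%C) - Im (f (0%R * w)%C)) <= Cmod w * M)%R.
  { apply H2; intros s Hs; [now apply derivable_pt_lim_ray_Im, Hf|].
    eapply Rle_trans; [apply im_le_Cmod|now apply B]. }
  lra.
Qed.

(* On a ray through the singular point 0, the equation reads
   z W'' = - c W' + O(z W', W).  As Re c > 0 it forbids a positive maximum of |W'| away
   from 0, provided that the ray is so short that W, being bounded by the integral of W',
   does not compensate the term - c W'. *)
Lemma ode_unique (E : hge) (c : R) (W W1 W2 : C -> C) :
  hgC E = c -> (0 < c)%R -> jet2 W W1 W2 0 ->
  locally (0 : C) (fun w => ode E w (W w) (W1 w) (W2 w) = 0) ->
  W 0 = 0 -> locally (0 : C) (fun w => W w = 0).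
Proof.
  intros Ec Hc HJ HO HW0. unfold jet2 in HJ.
  assert (HL := filter_and _ _ HJ HO).
  apply locally_C_Cmod in HL. destruct HL as [d [Hd HL]].
  set (p := hgA E + hgB E + 1) in *. set (q := hgA E * hgB E).
  pose proof (Cmod_ge_0 p) as Hp. pose proof (Cmod_ge_0 q) as Hq.
  (* On the ray z W'' = r - c W' with |r| <= (k - 1) |w| M at the maximum, so |w| < c / k makes the
     term - c W' dominate. *)
  set (k := (2 * (c + Cmod p + 2 * Cmod q) + Cmod p + 2 * Cmod q + 1)%R).
  assert (Hk : (1 <= k)%R) by (unfold k; lra).
  apply locally_C_Cmod. exists (Rmin d (Rmin (1 / 2) (c / k))).
  assert (Hck : (0 < c / k)%R) by (apply Rdiv_lt_0_compat; lra).
  split; [repeat apply Rmin_glb_lt; lra|]. intros w Hw.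
  replace (w - 0) with w in Hw by ring.
  assert (Hw1 := Rlt_le_trans _ _ _ Hw (Rmin_l _ _)).
  assert (Hw2 := Rlt_le_trans _ _ _ Hw (Rmin_r _ _)).
  assert (Hw3 := Rlt_le_trans _ _ _ Hw2 (Rmin_l _ _)).
  assert (Hw4 := Rlt_le_trans _ _ _ Hw2 (Rmin_r _ _)).
  pose proof (Cmod_ge_0 w) as Hw0.
  assert (Hwk : (Cmod w * k < c)%R).
  { apply (Rmult_lt_compat_r k) in Hw4; [|lra].
    replace (c / k * k)%R with c in Hw4 by (field; lra). exact Hw4. }
  assert (HR : forall t : R, (0 <= t <= 1)%R ->
    (is_derive W (t * w) (W1 (t * w)) /\ is_derive W1 (t * w) (W2 (t * w))) /\
    ode E (t * w) (W (t * w)) (W1 (t * w)) (W2 (t * w)) = 0).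
  { intros t Ht. apply HL. replace (t * w - 0) with (t * w) by ring.
    rewrite Cmod_mult, Cmod_R, Rabs_pos_eq by lra. nra. }
  set (V := fun t : R => W1 (t * w)).
  (* The squared modulus of W' is differentiable even where W' vanishes. *)
  set (N := fun t : R => (Re (V t) * Re (V t) + Im (V t) * Im (V t))%R).
  set (N1 := fun t : R => (2 * (Re (V t) * Re (w * W2 (t * w))%C
                           + Im (V t) * Im (w * W2 (t * w))%C))%R).
  assert (HN : forall t, (0 <= t <= 1)%R -> derivable_pt_lim N t (N1 t)).
  { intros t Ht. destruct (HR t Ht) as [[_ H2] _].
    assert (Da := derivable_pt_lim_ray_Re _ _ _ _ H2).
    assert (Db := derivable_pt_lim_ray_Im _ _ _ _ H2).
    assert (Dc := derivable_pt_lim_plus _ _ _ _ _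
      (derivable_pt_lim_mult _ _ _ _ _ Da Da) (derivable_pt_lim_mult _ _ _ _ _ Db Db)).
    unfold N1, V.
    match type of Dc with derivable_pt_lim _ _ ?l =>
      match goal with |- derivable_pt_lim _ _ ?l' => replace l' with l by ring end end.
    exact Dc. }
  destruct (continuity_ab_maj N 0 1 ltac:(lra)) as [t0 [Hmax Ht0]].
  { intros t Ht. apply derivable_continuous_pt. exists (N1 t). now apply HN. }
  assert (NV : forall t, N t = (Cmod (V t) * Cmod (V t))%R).
  { intros t. unfold N. now rewrite Cmod_sqr. }
  set (M := Cmod (V t0)).
  assert (HM0 : (0 <= M)%R) by apply Cmod_ge_0.
  assert (HM : forall t, (0 <= t <= 1)%R -> (Cmod (V t) <= M)%R).
  { intros t Ht. specialize (Hmax t Ht). rewrite !NV in Hmax.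
    pose proof (Cmod_ge_0 (V t)). apply Rsqr_incr_0; auto. }
  assert (HWM : forall t, (0 <= t <= 1)%R -> (Cmod (W (t * w)%C) <= 2 * Cmod w * M)%R).
  { intros t Ht. replace (W (t * w)) with (W (t * w) - W 0) by (rewrite HW0; ring).
    apply Cmod_ray_bound with W1; auto. intros s Hs. now apply HR. }
  assert (HMz : M = 0%R).
  { apply Rle_antisym; [|exact HM0]. apply Rnot_lt_le. intros HMp.
    destruct (HR t0 Ht0) as [_ HO0]. unfold ode in HO0. fold p q in HO0. rewrite Ec in HO0.
    change (W1 (t0 * w)) with (V t0) in HO0.
    specialize (HWM t0 Ht0).
    set (z := t0 * w) in *. set (u := z * W2 z).
    assert (Hz : (Cmod z <= Cmod w)%R).
    { unfold z. rewrite Cmod_mult, Cmod_R, Rabs_pos_eq by lra. nra. }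
    pose proof (Cmod_ge_0 z) as Hz0.
    (* The equation is solved for u = z W'' with z u left on the right; as |z| <= 1/2, this term is
       absorbed in the bound for |u|. *)
    assert (Eu : u = z * u + (p * z - c) * V t0 + q * W z).
    { replace u with (z * u + (p * z - c) * V t0 + q * W z
        + (z * (1 - z) * W2 z + (c - p * z) * V t0 - q * W z)) at 1
        by (unfold u; ring). rewrite HO0. ring. }
    assert (HqW : (Cmod (q * W z) <= Cmod q * (2 * Cmod w * M))%R).
    { rewrite Cmod_mult. now apply Rmult_le_compat_l. }
    assert (HpV : (Cmod (p * z * V t0) <= Cmod p * Cmod w * M)%R).
    { rewrite !Cmod_mult. fold M. apply Rmult_le_compat_r; [exact HM0|].
      now apply Rmult_le_compat_l. }
    assert (Hu : (Cmod u <= 2 * (c + Cmod p + 2 * Cmod q) * M)%R).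
    { assert (T : (Cmod u <= Cmod (z * u) + c * M + Cmod (p * z * V t0)
                    + Cmod (q * W z))%R).
      { rewrite Eu at 1.
        replace (z * u + (p * z - c) * V t0 + q * W z)
          with (z * u + - (c * V t0) + p * z * V t0 + q * W z) by ring.
        eapply Rle_trans; [apply Cmod_triangle|]. apply Rplus_le_compat_r.
        eapply Rle_trans; [apply Cmod_triangle|]. apply Rplus_le_compat_r.
        eapply Rle_trans; [apply Cmod_triangle|]. apply Rplus_le_compat_l.
        rewrite Cmod_opp, Cmod_mult, Cmod_R, Rabs_pos_eq by lra. fold M. lra. }
      rewrite Cmod_mult in T. pose proof (Cmod_ge_0 u).
      assert (Cmod z * Cmod u <= 1 / 2 * Cmod u)%R by (apply Rmult_le_compat_r; lra).
      assert (Cmod p * Cmod w * M <= Cmod p * M)%R.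
      { apply Rmult_le_compat_r; [exact HM0|]. nra. }
      assert (Cmod q * (2 * Cmod w * M) <= Cmod q * (2 * M))%R.
      { apply Rmult_le_compat_l; [exact Hq|]. nra. }
      nra. }
    set (r := z * u + p * z * V t0 + q * W z).
    assert (Hr : (Cmod r <= (k - 1) * Cmod w * M)%R).
    { unfold r. eapply Rle_trans; [apply Cmod_triangle|].
      assert (T := Cmod_triangle (z * u) (p * z * V t0)).
      rewrite (Cmod_mult z u) in T.
      assert (Cmod z * Cmod u <= Cmod w * (2 * (c + Cmod p + 2 * Cmod q) * M))%R
        by (apply Rmult_le_compat; auto using Cmod_ge_0).
      unfold k. nra. }
    assert (Er : u = r - c * V t0).
    { rewrite Eu at 1. unfold r. ring. }
    (* t0 N1(t0)/2 = Re (conj V u) = - c M^2 + Re (conj V r) *)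
    assert (EN : (t0 * N1 t0 = 2 * (Re (Cconj (V t0) * r) - c * (M * M)))%R).
    { unfold N1. fold z. unfold M. rewrite Cmod_sqr.
      transitivity (2 * (Re (V t0) * Re u + Im (V t0) * Im u))%R.
      - unfold u. generalize (W2 z) (V t0). intros a b. unfold z.
        destruct w, a, b; simpl; ring.
      - rewrite Er. destruct (V t0), r; simpl; ring. }
    assert (HRe : (Re (Cconj (V t0) * r) <= M * ((k - 1) * Cmod w * M))%R).
    { eapply Rle_trans; [apply Rle_abs|]. eapply Rle_trans; [apply re_le_Cmod|].
      rewrite Cmod_mult, Cmod_conj. fold M. now apply Rmult_le_compat_l. }
    assert (Hneg : (t0 * N1 t0 < 0)%R).
    { rewrite EN. assert (0 < M * M)%R by now apply Rmult_lt_0_compat.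
      assert (M * ((k - 1) * Cmod w * M) <= Cmod w * k * (M * M))%R.
      { replace (M * ((k - 1) * Cmod w * M))%R with (Cmod w * (k - 1) * (M * M))%R by ring.
        apply Rmult_le_compat_r; [lra|]. nra. }
      assert (Cmod w * k * (M * M) < c * (M * M))%R by now apply Rmult_lt_compat_r.
      lra. }
    (* The strict inequality excludes a maximum at the singular point itself; elsewhere the maximum
       forces N1 >= 0, a contradiction. *)
    destruct (Req_dec t0 0) as [Ht|Ht]; [rewrite Ht in Hneg; lra|].
    assert (0 <= N1 t0)%R.
    { apply (derivable_pt_lim_max_left N t0); [lra|now apply HN|].
      intros s Hs. apply Hmax. lra. }
    nra. }
  apply Cmod_eq_0, Rle_antisym; [|apply Cmod_ge_0].
  specialize (HWM 1%R ltac:(lra)). rewrite HMz, Cmult_1_l in HWM. lra.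
Qed.

(** * Power series and the hypergeometric series *)

(** [CSeries] assigns a value to every sequence, so absolute convergence is carried along to make
    the value a genuine sum. *)
Definition is_CSeries (u : nat -> C) (s : C) : Prop :=
  ex_series (fun n => Cmod (u n)) /\ CSeries u = s.

Lemma is_CSeries_Re_Im (u : nat -> C) (s : C) : is_CSeries u s ->
  is_series (fun n => Re (u n)) (Re s) /\ is_series (fun n => Im (u n)) (Im s).
Proof.
  intros [H <-]. unfold CSeries. split; apply Series_correct;
    (eapply (ex_series_le (V := R_CompleteNormedModule)); [|exact H]); intros n.
  - apply re_le_Cmod.
  - apply im_le_Cmod.
Qed.

Lemma CSeries_intro (u : nat -> C) (s : C) :
  is_series (fun n => Re (u n)) (Re s) -> is_series (fun n => Im (u n)) (Im s) ->
  CSeries u = s.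
Proof.
  intros H1 H2. unfold CSeries. rewrite (is_series_unique _ _ H1), (is_series_unique _ _ H2).
  now destruct s.
Qed.

Lemma CSeries_ext (u v : nat -> C) : (forall n, u n = v n) -> CSeries u = CSeries v.
Proof.
  intros E. unfold CSeries.
  rewrite (Series_ext (fun n => Re (u n)) (fun n => Re (v n))) by (intros; now rewrite E).
  rewrite (Series_ext (fun n => Im (u n)) (fun n => Im (v n))) by (intros; now rewrite E).
  reflexivity.
Qed.

Lemma is_CSeries_ext (u v : nat -> C) (s : C) :
  (forall n, u n = v n) -> is_CSeries u s -> is_CSeries v s.
Proof.
  intros E [H <-]. split.
  - eapply ex_series_ext; [|exact H]. intros n. cbv beta. now rewrite E.
  - symmetry. now apply CSeries_ext.
Qed.

Lemma is_CSeries_plus (u v : nat -> C) (s t : C) :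
  is_CSeries u s -> is_CSeries v t -> is_CSeries (fun n => u n + v n) (s + t).
Proof.
  intros Hu Hv.
  destruct (is_CSeries_Re_Im _ _ Hu) as [U1 U2]. destruct (is_CSeries_Re_Im _ _ Hv) as [V1 V2].
  split.
  - eapply (ex_series_le (V := R_CompleteNormedModule));
      [|exact (ex_series_plus _ _ (proj1 Hu) (proj1 Hv))].
    intros n. unfold norm; simpl. unfold abs; simpl.
    rewrite Rabs_pos_eq by apply Cmod_ge_0. apply Cmod_triangle.
  - apply CSeries_intro; [exact (is_series_plus _ _ _ _ U1 V1)|
                          exact (is_series_plus _ _ _ _ U2 V2)].
Qed.

Lemma is_CSeries_scal (c : C) (u : nat -> C) (s : C) :
  is_CSeries u s -> is_CSeries (fun n => c * u n) (c * s).
Proof.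
  intros Hu. destruct (is_CSeries_Re_Im _ _ Hu) as [U1 U2]. split.
  - eapply ex_series_ext; [|exact (ex_series_scal (Cmod c) _ (proj1 Hu))].
    intros n. simpl. now rewrite Cmod_mult.
  - apply CSeries_intro.
    + refine (is_series_ext _ _ _ _ (is_series_minus _ _ _ _
        (is_series_scal (Re c) _ _ U1) (is_series_scal (Im c) _ _ U2))).
      intros n. reflexivity.
    + refine (is_series_ext _ _ _ _ (is_series_plus _ _ _ _
        (is_series_scal (Re c) _ _ U2) (is_series_scal (Im c) _ _ U1))).
      intros n. reflexivity.
Qed.

Lemma is_CSeries_shift (u : nat -> C) (s : C) :
  u O = 0 -> is_CSeries (fun n => u (S n)) s -> is_CSeries u s.
Proof.
  intros H0 Hu. destruct (is_CSeries_Re_Im _ _ Hu) as [U1 U2]. split.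
  - apply (ex_series_incr_1 (fun n => Cmod (u n))). exact (proj1 Hu).
  - apply CSeries_intro.
    + apply (is_series_decr_1 (fun n => Re (u n))).
      match goal with |- is_series _ ?x => replace x with (Re s) end; [exact U1|].
      rewrite H0. unfold plus, opp; simpl. ring.
    + apply (is_series_decr_1 (fun n => Im (u n))).
      match goal with |- is_series _ ?x => replace x with (Im s) end; [exact U2|].
      rewrite H0. unfold plus, opp; simpl. ring.
Qed.

Lemma is_CSeries_bound (u : nat -> C) (s : C) (b : nat -> R) (t : R) :
  is_CSeries u s -> is_series b t -> (forall n, (Cmod (u n) <= b n)%R) ->
  (Cmod s <= 2 * t)%R.
Proof.
  intros Hu Hb H. destruct (is_CSeries_Re_Im _ _ Hu) as [U1 U2].
  assert (K : forall (p : nat -> R) (x : R), is_series p x ->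
    (forall n, (Rabs (p n) <= b n)%R) -> (Rabs x <= t)%R).
  { intros p x Hp Hpb. rewrite <- (is_series_unique _ _ Hp), <- (is_series_unique _ _ Hb).
    assert (Hex : ex_series (fun n => Rabs (p n))).
    { apply (ex_series_le (V := R_CompleteNormedModule)) with b; [|now exists t].
      intros n. unfold norm; simpl. unfold abs; simpl. rewrite Rabs_Rabsolu. apply Hpb. }
    eapply Rle_trans; [now apply Series_Rabs|].
    apply Series_le; [|now exists t]. intros n. split; [apply Rabs_pos|apply Hpb]. }
  eapply Rle_trans; [apply Cmod_le_Re_Im|].
  assert (Rabs (Re s) <= t)%R.
  { apply (K _ _ U1). intros n. eapply Rle_trans; [apply re_le_Cmod|apply H]. }
  assert (Rabs (Im s) <= t)%R.
  { apply (K _ _ U2). intros n. eapply Rle_trans; [apply im_le_Cmod|apply H]. }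
  lra.
Qed.

(** A growth bound replaces the radius of convergence, which is at least 1/r. Each differentiation
    is paid for by doubling r, since n + 1 <= 2^n; the loss is harmless near 0. *)
Definition geom_bounded (r : R) (a : nat -> C) : Prop :=
  exists M, (0 <= M)%R /\ forall n, (Cmod (a n) <= M * r ^ n)%R.

Definition power_series (a : nat -> C) (z : C) : C := CSeries (fun n => a n * z ^ n).

Definition power_series_D (a : nat -> C) (n : nat) : C := INR (S n) * a (S n).

Lemma INR_le_pow2 (n : nat) : (INR (S n) <= 2 ^ n)%R.
Proof.
  induction n as [|n IH]; [simpl; lra|]. rewrite S_INR. cbn [pow].
  assert (1 <= 2 ^ n)%R by (apply pow_R1_Rle; lra). lra.
Qed.

Lemma geom_bounded_power_series_D (r : R) (a : nat -> C) : (0 <= r)%R ->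
  geom_bounded r a -> geom_bounded (2 * r) (power_series_D a).
Proof.
  intros Hr [M [HM H]]. exists (M * r)%R. split; [now apply Rmult_le_pos|].
  intros n. unfold power_series_D. rewrite Cmod_mult, Cmod_R, Rabs_pos_eq by apply pos_INR.
  rewrite Rpow_mult_distr.
  replace (M * r * (2 ^ n * r ^ n))%R with (2 ^ n * (M * r ^ S n))%R by (simpl; ring).
  apply Rmult_le_compat; auto using pos_INR, Cmod_ge_0, INR_le_pow2.
Qed.

Lemma geom_bounded_mul_index (r : R) (a : nat -> C) : (0 <= r)%R ->
  geom_bounded r a -> geom_bounded (2 * r) (fun n => INR n * a n).
Proof.
  intros Hr [M [HM H]]. exists M. split; [exact HM|].
  intros n. rewrite Cmod_mult, Cmod_R, Rabs_pos_eq by apply pos_INR.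
  rewrite Rpow_mult_distr.
  replace (M * (2 ^ n * r ^ n))%R with (2 ^ n * (M * r ^ n))%R by ring.
  apply Rmult_le_compat; auto using pos_INR, Cmod_ge_0.
  eapply Rle_trans; [|apply INR_le_pow2]. apply le_INR. lia.
Qed.

Lemma is_CSeries_power_series (r : R) (a : nat -> C) (z : C) : geom_bounded r a ->
  (0 <= r)%R -> (r * Cmod z < 1)%R -> is_CSeries (fun n => a n * z ^ n) (power_series a z).
Proof.
  intros [M [HM H]] Hr Hz. split; [|reflexivity].
  assert (Hq : (0 <= r * Cmod z)%R) by (apply Rmult_le_pos; auto using Cmod_ge_0).
  apply (ex_series_le (V := R_CompleteNormedModule)) with (fun n => M * (r * Cmod z) ^ n)%R.
  - intros n. unfold norm; simpl. unfold abs; simpl.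
    rewrite Rabs_pos_eq by apply Cmod_ge_0. rewrite Cmod_mult, Cmod_pow, Rpow_mult_distr.
    rewrite <- Rmult_assoc. apply Rmult_le_compat_r; [apply pow_le, Cmod_ge_0|apply H].
  - apply (ex_series_scal M (fun n => (r * Cmod z) ^ n)%R). apply ex_series_geom. now rewrite Rabs_pos_eq.
Qed.

Lemma power_series_shift (r : R) (b : nat -> C) (z : C) : b O = 0 ->
  geom_bounded r (fun n => b (S n)) -> (0 <= r)%R -> (r * Cmod z < 1)%R ->
  is_CSeries (fun n => b n * z ^ n) (z * power_series (fun n => b (S n)) z).
Proof.
  intros H0 Hb Hr Hz. apply is_CSeries_shift; [rewrite H0; ring|].
  eapply is_CSeries_ext; [|exact (is_CSeries_scal z _ _ (is_CSeries_power_series _ _ _ Hb Hr Hz))].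
  intros n. rewrite Cpow_S. ring.
Qed.

Section PowerEstimates.
Variables (w z : C) (r : R).
Hypotheses (Hr : (0 < r)%R) (Hw : (Cmod w <= r)%R) (Hz : (Cmod z <= r)%R).

(** Multiplication by r turns the usual factor n r^(n-1) into n r^n, which avoids a predecessor in
    the exponent. *)
Lemma pow_diff_bound (n : nat) :
  (Cmod (w ^ n - z ^ n) * r <= INR n * r ^ n * Cmod (w - z))%R.
Proof.
  induction n as [|n IH].
  - simpl. replace (1 - 1) with (RtoC 0) by ring. rewrite Cmod_0. lra.
  - rewrite !Cpow_S.
    replace (w * w ^ n - z * z ^ n) with (w * (w ^ n - z ^ n) + (w - z) * z ^ n) by ring.
    assert (T := Cmod_triangle (w * (w ^ n - z ^ n)) ((w - z) * z ^ n)).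
    rewrite !Cmod_mult, Cmod_pow in T.
    assert (Cmod w * Cmod (w ^ n - z ^ n) <= r * Cmod (w ^ n - z ^ n))%R
      by (apply Rmult_le_compat_r; auto using Cmod_ge_0).
    assert (Cmod z ^ n <= r ^ n)%R by (apply pow_incr; split; auto using Cmod_ge_0).
    assert (Cmod (w - z) * Cmod z ^ n <= Cmod (w - z) * r ^ n)%R
      by (apply Rmult_le_compat_l; auto using Cmod_ge_0).
    rewrite S_INR. cbn [pow].
    apply (Rmult_le_compat_l r) in IH; [|lra]. nra.
Qed.

Definition pow_deriv (n : nat) : C := INR n * z ^ pred n.

Lemma pow_deriv_S (n : nat) : pow_deriv (S n) = z ^ n + z * pow_deriv n.
Proof.
  unfold pow_deriv. destruct n as [|n]; [simpl; ring|].
  rewrite (S_INR (S n)), RtoC_plus. cbn [pred]. rewrite Cpow_S. ring.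
Qed.

(** The Taylor remainders satisfy R_(n+1) = z R_n + (w - z) (w^n - z^n), and n^2 + n <= (n + 1)^2
    closes the induction. *)
Lemma pow_taylor_bound (n : nat) :
  (Cmod (w ^ n - z ^ n - (w - z) * pow_deriv n) * (r * r)
   <= INR n * INR n * r ^ n * (Cmod (w - z) * Cmod (w - z)))%R.
Proof.
  induction n as [|n IH].
  - unfold pow_deriv; simpl.
    replace (1 - 1 - (w - z) * (0 * 1)) with (RtoC 0) by ring. rewrite Cmod_0. lra.
  - rewrite pow_deriv_S, !Cpow_S.
    replace (w * w ^ n - z * z ^ n - (w - z) * (z ^ n + z * pow_deriv n))
      with (z * (w ^ n - z ^ n - (w - z) * pow_deriv n) + (w - z) * (w ^ n - z ^ n)) by ring.
    assert (T := Cmod_triangle (z * (w ^ n - z ^ n - (w - z) * pow_deriv n))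
                   ((w - z) * (w ^ n - z ^ n))).
    rewrite !Cmod_mult in T.
    set (e := Cmod (w ^ n - z ^ n - (w - z) * pow_deriv n)) in *.
    set (d := Cmod (w - z)) in *.
    assert (He : (0 <= e)%R) by apply Cmod_ge_0.
    assert (Hd : (0 <= d)%R) by apply Cmod_ge_0.
    assert (H1 : (Cmod z * e <= r * e)%R) by now apply Rmult_le_compat_r.
    assert (H2 := pow_diff_bound n). fold d in H2.
    assert (H3 : (d * Cmod (w ^ n - z ^ n) * (r * r) <= d * r * (INR n * r ^ n * d))%R).
    { replace (d * Cmod (w ^ n - z ^ n) * (r * r))%R
        with (d * r * (Cmod (w ^ n - z ^ n) * r))%R by ring.
      apply Rmult_le_compat_l; [nra|exact H2]. }
    assert (H4 : (r * e * (r * r) <= r * (INR n * INR n * r ^ n * (d * d)))%R).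
    { replace (r * e * (r * r))%R with (r * (e * (r * r)))%R by ring.
      apply Rmult_le_compat_l; [lra|exact IH]. }
    assert (H5 : (0 <= r * r ^ n * (d * d) * (INR n + 1))%R).
    { assert (0 < r ^ n)%R by now apply pow_lt. pose proof (pos_INR n).
      repeat apply Rmult_le_pos; lra. }
    apply Rle_trans with ((r * e + d * Cmod (w ^ n - z ^ n)) * (r * r))%R.
    { apply Rmult_le_compat_r; [nra|lra]. }
    rewrite S_INR. cbn [pow]. nra.
Qed.
End PowerEstimates.

Lemma power_series_derive (B : R) (a : nat -> C) (z : C) : (0 < B)%R -> geom_bounded B a ->
  (8 * B * Cmod z < 1)%R -> is_derive (power_series a) z (power_series (power_series_D a) z).
Proof.
  (* With this radius B * 4 * r = 1/2. As n^2 <= 4^n, the n-th remainder term is at most a constant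
     times |w - z|^2 / 2^n, which is summable. *)
  intros HB Ha Hz. set (r := (/ (8 * B))%R).
  assert (Hr : (0 < r)%R) by (apply Rinv_0_lt_compat; lra).
  assert (HrB : (8 * B * r = 1)%R) by (unfold r; field; lra).
  assert (Hzr : (Cmod z < r)%R).
  { apply (Rmult_lt_reg_l (8 * B)); [lra|]. rewrite HrB. lra. }
  destruct Ha as [M [HM Ha]].
  assert (Ha' : geom_bounded B a) by (exists M; auto).
  apply is_derive_C_eps. intros e He.
  assert (HK : (0 < e / (4 * M / (r * r) + 1))%R).
  { apply Rdiv_lt_0_compat; [exact He|].
    assert (0 <= 4 * M / (r * r))%R by (apply Rdiv_le_0_compat; nra). lra. }
  exists (Rmin (r - Cmod z) (e / (4 * M / (r * r) + 1))).
  split; [apply Rmin_glb_lt; lra|]. intros w Hw.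
  assert (Hw1 := Rlt_le_trans _ _ _ Hw (Rmin_l _ _)).
  assert (Hw2 := Rlt_le_trans _ _ _ Hw (Rmin_r _ _)).
  set (d := Cmod (w - z)) in *.
  assert (Hd : (0 <= d)%R) by apply Cmod_ge_0.
  assert (Hwr : (Cmod w <= r)%R).
  { replace w with ((w - z) + z) by ring.
    eapply Rle_trans; [apply Cmod_triangle|]. fold d. lra. }
  assert (S1 : is_CSeries (fun n => a n * w ^ n) (power_series a w)).
  { apply (is_CSeries_power_series B); [exact Ha'|lra|].
    assert (B * Cmod w <= B * r)%R by (apply Rmult_le_compat_l; lra). lra. }
  assert (S2 : is_CSeries (fun n => a n * z ^ n) (power_series a z)).
  { apply (is_CSeries_power_series B); [exact Ha'|lra|].
    assert (B * Cmod z <= B * r)%R by (apply Rmult_le_compat_l; lra). lra. }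
  assert (S3 : is_CSeries (fun n => a n * pow_deriv z n) (power_series (power_series_D a) z)).
  { apply is_CSeries_shift; [unfold pow_deriv; simpl; ring|].
    eapply is_CSeries_ext; [|apply (is_CSeries_power_series (2 * B) (power_series_D a) z)].
    - intros n. unfold power_series_D, pow_deriv. cbn [pred]. ring.
    - apply geom_bounded_power_series_D; [lra|exact Ha'].
    - lra.
    - pose proof (Cmod_ge_0 z). nra. }
  assert (S4 := is_CSeries_plus _ _ _ _ S1 (is_CSeries_plus _ _ _ _
     (is_CSeries_scal (- (1)) _ _ S2) (is_CSeries_scal (- (w - z)) _ _ S3))).
  replace (power_series a w - power_series a z - (w - z) * power_series (power_series_D a) z)
    with (power_series a w + (- (1) * power_series a z + - (w - z) * power_series (power_series_D a) z)) by ring.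
  assert (G : is_series (fun n => M * (d * d) / (r * r) * (1 / 2) ^ n)%R
                (M * (d * d) / (r * r) * / (1 - 1 / 2))%R).
  { apply (is_series_scal (M * (d * d) / (r * r))%R (fun n => (1 / 2) ^ n)%R (/ (1 - 1 / 2))%R).
    apply is_series_geom. rewrite Rabs_pos_eq; lra. }
  eapply Rle_trans; [apply (is_CSeries_bound _ _ _ _ S4 G)|].
  - intros n.
    replace (a n * w ^ n + (- (1) * (a n * z ^ n) + - (w - z) * (a n * pow_deriv z n)))
      with (a n * (w ^ n - z ^ n - (w - z) * pow_deriv z n)) by ring.
    rewrite Cmod_mult.
    assert (T := pow_taylor_bound w z r Hr Hwr (Rlt_le _ _ Hzr) n). fold d in T.
    set (t := Cmod (w ^ n - z ^ n - (w - z) * pow_deriv z n)) in *.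
    assert (Ht : (0 <= t)%R) by apply Cmod_ge_0.
    apply Rle_trans with (M * B ^ n * t)%R; [apply Rmult_le_compat_r; auto|].
    assert (Hn : (INR n * INR n <= 4 ^ n)%R).
    { replace 4%R with (2 * 2)%R by ring. rewrite Rpow_mult_distr.
      assert (INR n <= 2 ^ n)%R
        by (eapply Rle_trans; [|apply INR_le_pow2]; apply le_INR; lia).
      apply Rmult_le_compat; auto using pos_INR. }
    assert (Hrr : (0 < r * r)%R) by nra.
    apply (Rmult_le_reg_r (r * r)); [exact Hrr|].
    apply Rle_trans with (M * B ^ n * (4 ^ n * r ^ n * (d * d)))%R.
    + rewrite Rmult_assoc. apply Rmult_le_compat_l.
      { apply Rmult_le_pos; [lra|]. apply pow_le; lra. }
      eapply Rle_trans; [exact T|]. apply Rmult_le_compat_r; [nra|].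
      apply Rmult_le_compat_r; [apply pow_le; lra|exact Hn].
    + apply Req_le.
      replace (1 / 2)%R with (B * (4 * r))%R by lra.
      rewrite !Rpow_mult_distr. field. lra.
  - assert (E : (2 * (M * (d * d) / (r * r) * / (1 - 1 / 2)) = 4 * M / (r * r) * d * d)%R)
      by (field; lra).
    rewrite E. apply Rmult_le_compat_r; [exact Hd|].
    assert (HC : (0 <= 4 * M / (r * r))%R) by (apply Rdiv_le_0_compat; nra).
    set (k := (4 * M / (r * r))%R) in *.
    apply Rle_trans with ((k + 1) * d)%R; [nra|].
    apply (Rmult_lt_compat_l (k + 1)) in Hw2; [|lra].
    replace ((k + 1) * (e / (k + 1)))%R with e in Hw2 by (field; lra). lra.
Qed.

Lemma jet2_power_series (a : nat -> C) : geom_bounded 1 a ->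
  jet2 (power_series a) (power_series (power_series_D a)) (power_series (power_series_D (power_series_D a))) 0.
Proof.
  intros Ha. unfold jet2. apply locally_C_Cmod. exists (1 / 16)%R. split; [lra|].
  intros w Hw. replace (w - 0) with w in Hw by ring. split.
  - apply (power_series_derive 1); [lra|exact Ha|lra].
  - apply (power_series_derive 2); [lra| |lra].
    replace 2%R with (2 * 1)%R by ring. apply geom_bounded_power_series_D; [lra|exact Ha].
Qed.

Lemma is_series_zero : is_series (fun _ : nat => 0%R) 0%R.
Proof.
  apply (filterlim_ext (fun _ => 0%R)).
  - intros n. symmetry. induction n as [|n IH]; [now rewrite sum_O|].
    rewrite sum_Sn, IH. apply Rplus_0_l.
  - apply filterlim_const.
Qed.

Lemma power_series_0 (a : nat -> C) : power_series a 0 = a O.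
Proof.
  unfold power_series. apply CSeries_intro; apply is_series_decr_1.
  - apply (is_series_ext (fun _ => 0%R)).
    + intros n. rewrite Cpow_S. destruct (a (S n)), (0 ^ n); simpl; ring.
    + match goal with |- is_series _ ?x => replace x with 0%R end; [apply is_series_zero|].
      unfold plus, opp; simpl. destruct (a O); simpl; ring.
  - apply (is_series_ext (fun _ => 0%R)).
    + intros n. rewrite Cpow_S. destruct (a (S n)), (0 ^ n); simpl; ring.
    + match goal with |- is_series _ ?x => replace x with 0%R end; [apply is_series_zero|].
      unfold plus, opp; simpl. destruct (a O); simpl; ring.
Qed.

Lemma ode_power_series (E : hge) (a : nat -> C) (z : C) : geom_bounded 1 a ->
  (forall n, INR (S n) * (hgC E + INR n) * a (S n)
             = (hgA E + INR n) * (hgB E + INR n) * a n) ->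
  (4 * Cmod z < 1)%R ->
  ode E z (power_series a z) (power_series (power_series_D a) z) (power_series (power_series_D (power_series_D a)) z) = 0.
Proof.
  intros Ha Hrec Hz. pose proof (Cmod_ge_0 z) as Hz0.
  assert (G1 : geom_bounded 2 (power_series_D a)).
  { replace 2%R with (2 * 1)%R by ring. apply geom_bounded_power_series_D; [lra|exact Ha]. }
  assert (G2 : geom_bounded 4 (power_series_D (power_series_D a))).
  { replace 4%R with (2 * 2)%R by ring. apply geom_bounded_power_series_D; [lra|exact G1]. }
  assert (G3 : geom_bounded 4 (fun n => INR n * power_series_D a n)).
  { replace 4%R with (2 * 2)%R by ring. apply geom_bounded_mul_index; [lra|exact G1]. }
  assert (S0 := is_CSeries_power_series 1 a z Ha ltac:(lra) ltac:(lra)).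
  assert (S1 := is_CSeries_power_series 2 _ z G1 ltac:(lra) ltac:(lra)).
  (* [T1], [T2] and [T3] are the series of z y', z y'' and z^2 y'', each indexed by the resulting
     power of z, so that the equation becomes the recursion coefficient by coefficient. *)
  assert (T1 := power_series_shift 2 (fun n => INR n * a n) z ltac:(simpl; ring) G1
                  ltac:(lra) ltac:(lra)).
  assert (T2 := power_series_shift 4 (fun n => INR n * power_series_D a n) z ltac:(simpl; ring) G2
                  ltac:(lra) ltac:(lra)).
  assert (T3 : is_CSeries (fun n => INR n * (INR n - 1) * a n * z ^ n)
                 (z * (z * power_series (power_series_D (power_series_D a)) z))).
  { destruct T2 as [_ T2]. change (power_series (fun n => INR n * power_series_D a n) z
      = z * power_series (power_series_D (power_series_D a)) z) in T2. rewrite <- T2.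
    assert (EQ : forall n, INR n * power_series_D a n = INR (S n) * (INR (S n) - 1) * a (S n)).
    { intros n. unfold power_series_D. rewrite S_INR, RtoC_plus. ring. }
    replace (power_series (fun n => INR n * power_series_D a n) z)
      with (power_series (fun n => INR (S n) * (INR (S n) - 1) * a (S n)) z)
      by (apply CSeries_ext; intros n; now rewrite EQ).
    apply (power_series_shift 4 (fun n => INR n * (INR n - 1) * a n)); [simpl; ring| |lra|lra].
    destruct G3 as [M [HM G3]]. exists M. split; [exact HM|].
    intros n. rewrite <- EQ. apply G3. }
  assert (TT := is_CSeries_plus _ _ _ _
    (is_CSeries_plus _ _ _ _ T2 (is_CSeries_scal (- (1)) _ _ T3))
    (is_CSeries_plus _ _ _ _ (is_CSeries_scal (hgC E) _ _ S1)
    (is_CSeries_plus _ _ _ _ (is_CSeries_scal (- (hgA E + hgB E + 1)) _ _ T1)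
       (is_CSeries_scal (- (hgA E * hgB E)) _ _ S0)))).
  unfold ode.
  match type of TT with is_CSeries _ ?x => transitivity x; [|] end.
  { cbv beta. change (fun n => INR (S n) * a (S n)) with (power_series_D a).
    change (fun n => INR (S n) * power_series_D a (S n)) with (power_series_D (power_series_D a)). ring. }
  assert (TZ := is_CSeries_scal 0 _ _ S0).
  destruct TZ as [_ TZ]. destruct TT as [_ TT]. rewrite <- TT.
  transitivity (CSeries (fun n => 0 * (a n * z ^ n))).
  - apply CSeries_ext. intros n. cbv beta.
    transitivity ((INR (S n) * (hgC E + INR n) * a (S n)
          - (hgA E + INR n) * (hgB E + INR n) * a n) * z ^ n).
    + unfold power_series_D. rewrite !S_INR, !RtoC_plus. ring.
    + rewrite Hrec. ring.
  - rewrite TZ. ring.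
Qed.

Definition hyp_coeff (a b c : C) (n : nat) : C :=
  Cpoch a n * Cpoch b n / (Cpoch c n * INR (fact n)).

Section Hypergeometric.
Variables a b c : R.
Hypotheses (Ha : (0 < a <= c)%R) (Hb : (0 < b <= 1)%R).

Lemma Cpoch_pos_neq_0 (n : nat) : Cpoch c n <> 0.
Proof.
  induction n as [|n IH]; simpl; [exact C1_nz|]. apply Cmult_neq_0; [exact IH|].
  rewrite <- RtoC_plus. intros H. apply RtoC_inj in H. pose proof (pos_INR n). lra.
Qed.

Lemma hyp_coeff_rec (n : nat) :
  INR (S n) * (c + INR n) * hyp_coeff a b c (S n)
  = (a + INR n) * (b + INR n) * hyp_coeff a b c n.
Proof.
  unfold hyp_coeff. rewrite fact_simpl, mult_INR, RtoC_mult. cbn [Cpoch].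
  assert (H1 := Cpoch_pos_neq_0 (S n)). cbn [Cpoch] in H1.
  assert (H2 := Cpoch_pos_neq_0 n).
  assert (H3 : RtoC (INR (S n)) <> 0).
  { intros H. apply RtoC_inj in H. now apply not_0_INR in H. }
  assert (H4 : RtoC (INR (fact n)) <> 0).
  { intros H. apply RtoC_inj in H. now apply INR_fact_neq_0 in H. }
  assert (H5 : c + INR n <> 0) by (intros H; apply H1; rewrite H; ring).
  field. auto.
Qed.

(** The quotient of successive coefficients is (a + n)(b + n) / ((c + n)(1 + n)), at most 1 because
    a <= c and b <= 1. *)
Lemma hyp_coeff_bounded : geom_bounded 1 (hyp_coeff a b c).
Proof.
  exists 1%R. split; [lra|]. intros n. rewrite pow1, Rmult_1_r.
  induction n as [|n IH].
  - unfold hyp_coeff; simpl. replace (1 * 1 / (1 * 1)) with (RtoC 1) by field.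
    rewrite Cmod_1. lra.
  - assert (H := f_equal Cmod (hyp_coeff_rec n)). rewrite !Cmod_mult in H.
    rewrite <- !RtoC_plus, !Cmod_R in H. pose proof (pos_INR n) as Hn.
    rewrite S_INR in H. rewrite !Rabs_pos_eq in H by lra.
    set (p := Cmod (hyp_coeff a b c n)) in *. set (q := Cmod (hyp_coeff a b c (S n))) in *.
    assert (Hp : (0 <= p)%R) by apply Cmod_ge_0.
    assert (Hk : (0 < (INR n + 1) * (c + INR n))%R) by (apply Rmult_lt_0_compat; lra).
    apply (Rmult_le_reg_l ((INR n + 1) * (c + INR n))); [exact Hk|]. rewrite H, Rmult_1_r.
    apply Rle_trans with ((a + INR n) * (b + INR n) * 1)%R.
    + apply Rmult_le_compat_l; [|exact IH]. apply Rmult_le_pos; lra.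
    + rewrite Rmult_1_r, (Rmult_comm (INR n + 1)). apply Rmult_le_compat; lra.
Qed.

Lemma hyp2F1_solution : exists y1 y2 : C -> C,
  jet2 (hyp2F1 a b c) y1 y2 0 /\
  locally (0 : C) (fun z => ode (Hge a b c) z (hyp2F1 a b c z) (y1 z) (y2 z) = 0) /\
  hyp2F1 a b c 0 = 1.
Proof.
  assert (HG := hyp_coeff_bounded).
  exists (power_series (power_series_D (hyp_coeff a b c))), (power_series (power_series_D (power_series_D (hyp_coeff a b c)))).
  split; [exact (jet2_power_series _ HG)|split].
  - apply locally_C_Cmod. exists (1 / 4)%R. split; [lra|].
    intros z Hz. replace (z - 0) with z in Hz by ring.
    apply (ode_power_series (Hge a b c) (hyp_coeff a b c)); [exact HG|exact hyp_coeff_rec|lra].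
  - change (power_series (hyp_coeff a b c) 0 = 1). rewrite power_series_0. unfold hyp_coeff; simpl. field.
Qed.
End Hypergeometric.

(** * The covering phi5 and the identities *)

Lemma locally_neq_0 (g : C -> C) (x l : C) :
  is_derive g x l -> g x <> 0 -> locally x (fun w => g w <> 0).
Proof.
  intros Hg H0. apply Cmod_gt_0 in H0.
  generalize (is_derive_C_cont g x l Hg _ H0). apply filter_imp.
  intros w Hw E. rewrite E in Hw. replace (0 - g x) with (- g x) in Hw by ring.
  rewrite Cmod_opp in Hw. lra.
Qed.

Lemma jet2_minus (f f1 f2 g g1 g2 : C -> C) (z : C) :
  jet2 f f1 f2 z -> jet2 g g1 g2 z ->
  jet2 (fun w => f w - g w) (fun w => f1 w - g1 w) (fun w => f2 w - g2 w) z.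
Proof.
  unfold jet2. intros Hf Hg. generalize (filter_and _ _ Hf Hg). apply filter_imp.
  intros w [[Ha Hb] [Hc Hd]]. split; now apply C_derive_minus.
Qed.

Lemma C_derive_power (a : C) (L : C -> C) (w l : C) : is_derive L w l ->
  is_derive (fun v => Cexp (a * L v)) w (Cexp (a * L w) * (a * l)).
Proof.
  intros HL. eapply C_derive_eq.
  - apply (C_derive_comp Cexp (fun v => a * L v)); [apply C_derive_exp|].
    apply (C_derive_mult (fun _ => a) L); [apply C_derive_const|exact HL].
  - cbv beta. ring.
Qed.

(** Differentiating exp L = g suffices, so every holomorphic branch of the logarithm is covered, not
    only the principal one. *)
Lemma log_branch_derive (L g : C -> C) (x g1 : C) : ex_derive L x ->
  locally x (fun w => Cexp (L w) = g w) -> is_derive g x g1 ->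
  is_derive L x (g1 / g x).
Proof.
  intros HL HE Hg. assert (H := C_derive_correct L x (RtoC 0) HL).
  assert (H2 : is_derive (fun w => Cexp (L w)) x g1).
  { apply (C_derive_ext_loc g); [|exact Hg]. revert HE. now apply filter_imp. }
  apply is_C_derive_unique in H2.
  assert (H3 := C_derive_comp Cexp L x _ _ (C_derive_exp _) H).
  apply is_C_derive_unique in H3. rewrite H2 in H3.
  assert (E := locally_singleton _ _ HE). simpl in E. rewrite <- E, H3.
  eapply C_derive_eq; [exact H|]. field. apply Cexp_neq_0.
Qed.

Lemma hyp2F1_pullback (a b c a' b' c' : R) (t l l1 f f1 f2 K : C -> C) :
  (0 < a <= c)%R -> (0 < b <= 1)%R -> (0 < a' <= c')%R -> (0 < b' <= 1)%R ->
  locally (0 : C) (fun w => is_derive t w (t w * l w) /\ is_derive l w (l1 w)) ->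
  jet2 f f1 f2 0 -> t 0 = 1 -> f 0 = 0 ->
  locally (0 : C) (fun x => pullback_relations (Hge a b c) (Hge a' b' c') (K x)
    x (f x) (f1 x) (f2 x) (l x) (l1 x)) ->
  locally (0 : C) (fun x => hyp2F1 a' b' c' x = t x * hyp2F1 a b c (f x)).
Proof.
  intros Ha Hb Ha' Hb' Ht Hf Et Ef HK.
  destruct (hyp2F1_solution a b c Ha Hb) as (y1 & y2 & Jy & Oy & Ey).
  destruct (hyp2F1_solution a' b' c' Ha' Hb') as (Y1 & Y2 & JY & OY & EY).
  rewrite <- Ef in Jy at 1.
  assert (JP := jet2_pullback _ _ _ _ _ _ _ _ _ 0 Ht Hf Jy).
  assert (JW := jet2_minus _ _ _ _ _ _ _ JY JP).
  assert (Oy' : locally (0 : C) (fun w =>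
    ode (Hge a b c) (f w) (hyp2F1 a b c (f w)) (y1 (f w)) (y2 (f w)) = 0)).
  { apply locally_C_Cmod in Oy. destruct Oy as [d [Hd Oy]].
    assert (Hf0 := locally_singleton _ _ Hf). destruct Hf0 as [Hf0 _].
    generalize (is_derive_C_cont _ _ _ Hf0 d Hd). rewrite Ef. apply filter_imp.
    intros w Hw. now apply Oy. }
  assert (HW := ode_unique (Hge a' b' c') c' _ _ _ eq_refl ltac:(lra) JW).
  cbv beta in HW.
  assert (HO : locally (0 : C) (fun w => hyp2F1 a' b' c' w - t w * hyp2F1 a b c (f w) = 0)).
  { apply HW.
    - generalize (filter_and _ _ OY (filter_and _ _ Oy' HK)). apply filter_imp.
      intros w (H1 & H2 & H3).
      assert (HP := ode_pullback _ _ _ _ _ _ _ _ _ (t w)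
        (hyp2F1 a b c (f w)) (y1 (f w)) (y2 (f w)) H3).
      rewrite H2 in HP.
      match type of H1 with ?p = _ => match type of HP with ?q = _ =>
        transitivity (p - q) end end.
      + unfold ode; simpl hgA; simpl hgB; simpl hgC. ring.
      + rewrite H1, HP. ring.
    - rewrite Ef, EY, Ey, Et. ring. }
  revert HO. apply filter_imp. intros w Hw.
  replace (hyp2F1 a' b' c' w)
    with ((hyp2F1 a' b' c' w - t w * hyp2F1 a b c (f w)) + t w * hyp2F1 a b c (f w)) by ring.
  rewrite Hw. ring.
Qed.

Definition phi5_Q (x : C) : C := 4 * x - 2 - 11 * Ci.
Definition phi5_s (x : C) : C := 8 * x - 4 + 3 * Ci.
Definition phi5_P (x : C) : C :=
  32 * x ^ 3 + (-48 + 336 * Ci) * x ^ 2 + (98 - 336 * Ci) * x - (41 + 38 * Ci).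
Definition phi5_P' (x : C) : C :=
  96 * x ^ 2 + 2 * (-48 + 336 * Ci) * x + (98 - 336 * Ci).
Definition phi5_D1 (x : C) : C := 4 * Ci * phi5_Q x ^ 3 * phi5_P x / phi5_s x ^ 6.
Definition phi5_D2 (x : C) : C :=
  4 * Ci * phi5_Q x ^ 2 * (12 * phi5_P x * phi5_s x + phi5_Q x * phi5_P' x * phi5_s x
    - 48 * phi5_Q x * phi5_P x) / phi5_s x ^ 7.

Lemma phi5_den_minus_num (x : C) : phi5_den x - phi5_num x = - Ci * phi5_P x ^ 2.
Proof. unfold phi5_den, phi5_num, phi5_P. ring. Qed.

Lemma jet2_phi5 (x : C) : phi5_s x <> 0 -> jet2 phi5 phi5_D1 phi5_D2 x.
Proof.
  intros Hs.
  assert (Ds : is_derive phi5_s x (RtoC 8)) by (unfold phi5_s; C_derive; ring).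
  unfold jet2. generalize (locally_neq_0 _ _ _ Ds Hs). apply filter_imp.
  clear x Hs Ds. intros x Hs. split.
  - unfold phi5, phi5_num, phi5_den. C_derive; [apply Cpow_nz, Hs|].
    unfold phi5_D1, phi5_Q, phi5_P, phi5_s in *. cbn [Z.of_nat Pos.of_succ_nat Pos.succ].
    gauss_field.
  - unfold phi5_D1, phi5_Q, phi5_P, phi5_s. C_derive; [apply Cpow_nz, Hs|].
    unfold phi5_D2, phi5_Q, phi5_P, phi5_P', phi5_s in *.
    cbn [Z.of_nat Pos.of_succ_nat Pos.succ]. gauss_field.
Qed.

Definition E5 : hge := Hge (1 / 40) (9 / 40) (3 / 4).
Definition E5' : hge := Hge (3 / 20) (7 / 20) (3 / 4).

(** K is forced by the coefficient of y'': it is x (1 - x) phi5'^2 / (phi5 (1 - phi5)), where x (x -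
    1) and P^2 cancel. *)
Lemma phi5_relations (x : C) : phi5_s x <> 0 ->
  pullback_relations E5 E5' (4 * phi5_Q x ^ 2 / phi5_s x ^ 2)
    x (phi5 x) (phi5_D1 x) (phi5_D2 x) (- 1 / phi5_s x) (8 / phi5_s x ^ 2).
Proof.
  intros H. unfold E5, E5'; repeat split; simpl hgA; simpl hgB; simpl hgC.
  (* The factored form of 1 - phi5 keeps [phi5_P] as an atom, so its square cancels without
     expansion. *)
  - assert (E1 : 1 - phi5 x = - Ci * phi5_P x ^ 2 / phi5_s x ^ 5).
    { transitivity ((phi5_den x - phi5_num x) / phi5_den x).
      - unfold phi5. field. apply Cpow_nz, H.
      - now rewrite phi5_den_minus_num. }
    rewrite E1.
    change (phi5 x) with (4 * Ci * x * (x - 1) * phi5_Q x ^ 4 / phi5_s x ^ 5).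
    unfold phi5_D1. gauss_field.
  - unfold phi5_D1, phi5_D2, phi5, phi5_num, phi5_den, phi5_P, phi5_P', phi5_Q, phi5_s in *.
    gauss_field.
  - unfold phi5_Q, phi5_s in *. gauss_field.
Qed.

Lemma C_derive_neg_inv_phi5_s (x : C) : phi5_s x <> 0 ->
  is_derive (fun w => - 1 / phi5_s w) x (8 / phi5_s x ^ 2).
Proof.
  intros H. unfold phi5_s. C_derive; [exact H|]. unfold phi5_s in *. gauss_field.
Qed.

(** The inverse of the pole of phi5, so 1 - [theta5_slope] x is [phi5_s] scaled to the value 1 at 0.
    At this fivefold pole the exponents 1/40 and 9/40 of [E5] at infinity become 1/8 and 9/8, and
    the power -1/8 shifts them to 0 and 1. *)
Definition theta5_slope : C := 8 * (4 + 3 * Ci) / 25.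

Lemma phi5_s_theta5_base (x : C) : phi5_s x = (-4 + 3 * Ci) * (1 - theta5_slope * x).
Proof. unfold phi5_s, theta5_slope. field. Qed.

Lemma phi5_s_neq_0 (x : C) : 1 - theta5_slope * x <> 0 -> phi5_s x <> 0.
Proof.
  intros H. rewrite phi5_s_theta5_base. apply Cmult_neq_0; [|exact H].
  intros E. apply (f_equal Im) in E. simpl in E. lra.
Qed.

Lemma theta5_derive (L : C -> C) (x : C) : 1 - theta5_slope * x <> 0 ->
  is_derive L x (- theta5_slope / (1 - theta5_slope * x)) ->
  is_derive (fun w => Cexp (- (1 / 8) * L w)) x
    (Cexp (- (1 / 8) * L x) * (- 1 / phi5_s x)).
Proof.
  intros H HL. eapply C_derive_eq; [exact (C_derive_power _ _ _ _ HL)|].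
  f_equal. rewrite phi5_s_theta5_base. revert H. generalize (1 - theta5_slope * x). intros d H.
  unfold theta5_slope. gauss_field.
Qed.

Lemma Ci_neq_0 : Ci <> 0.
Proof. intros E. apply (f_equal Im) in E. simpl in E. lra. Qed.

Lemma Cinv_neq_0 (z : C) : z <> 0 -> / z <> 0.
Proof. intros H E. apply C1_nz. rewrite <- (Cinv_r z H), E. ring. Qed.

Lemma C_derive_theta5_base (x : C) : is_derive (fun w => 1 - theta5_slope * w) x (- theta5_slope).
Proof. C_derive. ring. Qed.

Lemma theta5_num_neq0 : exists x : C, Cpeval [RtoC 1; - theta5_slope] x <> 0.
Proof. exists (RtoC 0). simpl. replace (1 + 0 * (- theta5_slope + 0 * 0)) with (RtoC 1) by ring. exact C1_nz. Qed.

Lemma theta5_den_neq0 : exists x : C, Cpeval [RtoC 1] x <> 0.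
Proof. exists (RtoC 0). simpl. replace (1 + 0 * 0) with (RtoC 1) by ring. exact C1_nz. Qed.

Definition theta5 : list (ratfun * C) :=
  [(Ratfun _ _ theta5_num_neq0 theta5_den_neq0, - (1 / 8))].

(** All branches share the logarithmic derivative - 1 / [phi5_s]; the existence of a logarithm of
    the base already excludes the pole. *)
Lemma theta5_branch_derive (x : C) (t : C -> C) : power_product_branch theta5 x t ->
  phi5_s x <> 0 /\ t x <> 0 /\
  locally x (fun w => is_derive t w (t w * (- 1 / phi5_s w)) /\
                      is_derive (fun v => - 1 / phi5_s v) w (8 / phi5_s w ^ 2)).
Proof.
  simpl. intros (h & t' & (_ & L & HL) & Ht' & Ht).
  assert (HE : locally x (fun w => Cexp (L w) = 1 - theta5_slope * w)).
  { revert HL. apply filter_imp. intros w (_ & E & _). rewrite E. unfold Cpeval; simpl. field. }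
  assert (HT : locally x (fun w => t w = Cexp (- (1 / 8) * L w))).
  { generalize (filter_and _ _ HL (filter_and _ _ Ht' Ht)). apply filter_imp.
    intros w ((_ & _ & E1) & E2 & E3). rewrite E3, E1, E2. ring. }
  assert (H0 : locally x (fun w => 1 - theta5_slope * w <> 0)).
  { revert HE. apply filter_imp. intros w E. rewrite <- E. apply Cexp_neq_0. }
  split; [|split].
  - apply phi5_s_neq_0. now apply locally_singleton in H0.
  - apply locally_singleton in HT. rewrite HT. apply Cexp_neq_0.
  - apply locally_locally in HE. apply locally_locally in HT.
    generalize (filter_and _ _ (filter_and _ _ HE HT) (filter_and _ _ HL H0)).
    apply filter_imp. intros w ((Ew & Tw) & (Lw & _) & Nw). split.
    + apply (C_derive_ext_loc (fun v => Cexp (- (1 / 8) * L v))).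
      { revert Tw. apply filter_imp. now intros v ->. }
      apply locally_singleton in Tw. rewrite Tw.
      apply theta5_derive; [exact Nw|].
      apply (log_branch_derive L (fun v => 1 - theta5_slope * v)); [exact Lw|exact Ew|].
      apply C_derive_theta5_base.
    + apply C_derive_neg_inv_phi5_s, phi5_s_neq_0, Nw.
Qed.

Lemma phi5_P1_Fin (x : C) : phi5_s x <> 0 -> phi5_P1 (Fin x) = Fin (phi5 x).
Proof.
  intros H. simpl. destruct (Ceq_dec (phi5_den x) 0) as [E|E]; [|reflexivity].
  exfalso. revert E. apply Cpow_nz, H.
Qed.

Lemma C_derive_phi5_s (x : C) : is_derive phi5_s x (RtoC 8).
Proof. unfold phi5_s. C_derive. ring. Qed.

Lemma defines_pullback_phi5 : defines_pullback phi5_P1 E5 E5'.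
Proof.
  exists theta5. intros x z t y Hx0 Hx1 Hz Hz0 Hz1 HT Hy.
  destruct (theta5_branch_derive x t HT) as (Hs & Ht0 & Ht).
  rewrite phi5_P1_Fin in Hz by exact Hs. injection Hz as <-.
  assert (HJ := jet2_pullback _ _ _ _ _ _ _ _ _ x Ht (jet2_phi5 x Hs)
                  (twice_derivable_jet2 _ _ Hy)).
  assert (HE : locally x (fun w => t w * y (phi5 w) = t w * y (toC (phi5_P1 (Fin w))))).
  { generalize (locally_neq_0 _ _ _ (C_derive_phi5_s x) Hs). apply filter_imp.
    intros w Hw. now rewrite phi5_P1_Fin. }
  assert (HY := jet2_ext _ (fun w : C => t w * y (toC (phi5_P1 (Fin w)))) _ _ x HE HJ).
  cbv zeta. destruct (jet2_C_derive _ _ _ _ HY) as (HY0 & HY1 & HY2).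
  split; [exact HY0|]. unfold satisfies_at. rewrite HY1, HY2, phi5_P1_Fin by exact Hs.
  cbn [toC].
  change (ode E5 (phi5 x) (y (phi5 x)) (C_derive y (phi5 x))
    (C_derive (C_derive y) (phi5 x)) = 0 <-> ode E5' x (t x * y (phi5 x))
      (t x * (- 1 / phi5_s x * y (phi5 x) + phi5_D1 x * C_derive y (phi5 x)))
      (t x * ((- 1 / phi5_s x * (- 1 / phi5_s x) + 8 / phi5_s x ^ 2) * y (phi5 x)
        + (2 * (- 1 / phi5_s x) * phi5_D1 x + phi5_D2 x) * C_derive y (phi5 x)
        + phi5_D1 x * phi5_D1 x * C_derive (C_derive y) (phi5 x))) = 0).
  rewrite (ode_pullback _ _ _ _ _ _ _ _ _ _ _ _ _ (phi5_relations x Hs)).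
  split; [intros ->; ring|]. intros H.
  match goal with |- ?o = _ => destruct (Ceq_dec o 0) as [Ho|Hn]; [exact Ho|] end.
  exfalso. revert H. apply Cmult_neq_0; [|exact Hn].
  apply Cmult_neq_0; [exact Ht0|]. unfold Cdiv.
  (* The converse direction divides by theta K. K vanishes only at the zero of Q, which phi5 sends
     to the excluded value 0. *)
  assert (HQ : phi5_Q x <> 0).
  { intros HQ. apply Hz0.
    change (phi5 x) with (4 * Ci * x * (x - 1) * phi5_Q x ^ 4 / phi5_s x ^ 5).
    rewrite HQ. field. exact Hs. }
  apply Cmult_neq_0; [apply Cmult_neq_0|].
  - intros E. apply RtoC_inj in E. lra.
  - now apply Cpow_nz.
  - apply Cinv_neq_0. now apply Cpow_nz.
Qed.

Lemma Cpower_one (a : C) : Cpower 1 a = 1.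
Proof.
  unfold Cpower, Clog. rewrite Cmod_1, ln_1, Carg_atan by (simpl; lra).
  simpl. replace (0 / 1)%R with 0%R by field. rewrite atan_0.
  replace (a * (0%R, 0%R)) with (RtoC 0); [apply Cexp_0|].
  change (0%R, 0%R) with (RtoC 0). ring.
Qed.

Lemma C_derive_Cpower (g : C -> C) (a w g1 : C) : (0 < Re (g w))%R -> is_derive g w g1 ->
  is_derive (fun v => Cpower (g v) a) w (Cpower (g w) a * (a * (g1 / g w))).
Proof.
  intros Hr Hg. apply (C_derive_power a (fun v => Clog (g v))).
  eapply C_derive_eq; [exact (C_derive_comp Clog g w _ _ (C_derive_log _ Hr) Hg)|].
  reflexivity.
Qed.

Lemma locally_Re_pos (g : C -> C) (x l : C) : is_derive g x l -> (0 < Re (g x))%R ->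
  locally x (fun w => (0 < Re (g w))%R).
Proof.
  intros Hg Hr. assert (H := Re_pos_open _ Hr).
  apply locally_C_Cmod in H. destruct H as [d [Hd H]].
  generalize (is_derive_C_cont _ _ _ Hg d Hd). apply filter_imp. intros w. apply H.
Qed.

Lemma hyp2F1_identity_phi5 : locally (0 : C) (fun x : C =>
  hyp2F1 (3 / 20) (7 / 20) (3 / 4) x =
  Cpower (1 - 8 * (4 + 3 * Ci) / 25 * x) (- (1 / 8))
  * hyp2F1 (1 / 40) (9 / 40) (3 / 4) (phi5 x)).
Proof.
  (* Near 0 the base stays in the right half-plane, where the principal logarithm is holomorphic. *)
  assert (Hpos : locally (0 : C) (fun w => (0 < Re (1 - theta5_slope * w)%C)%R)).
  { apply (locally_Re_pos (fun w => 1 - theta5_slope * w) 0 _ (C_derive_theta5_base 0)).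
    replace (1 - theta5_slope * 0) with (RtoC 1) by ring. simpl. lra. }
  assert (Hs : locally (0 : C) (fun w => phi5_s w <> 0)).
  { revert Hpos. apply filter_imp. intros w Hw. apply phi5_s_neq_0. intros E.
    rewrite E in Hw. simpl in Hw. lra. }
  rewrite <- !RtoC_div by lra.
  apply (hyp2F1_pullback (1 / 40) (9 / 40) (3 / 4) (3 / 20) (7 / 20) (3 / 4)
    (fun x => Cpower (1 - theta5_slope * x) (- (1 / 8)%R)) (fun x => - 1 / phi5_s x)
    (fun x => 8 / phi5_s x ^ 2) phi5 phi5_D1 phi5_D2
    (fun x => 4 * phi5_Q x ^ 2 / phi5_s x ^ 2)); try lra.
  - generalize (filter_and _ _ Hpos Hs). apply filter_imp. intros w [Hw Hw'].
    split; [|now apply C_derive_neg_inv_phi5_s].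
    rewrite RtoC_div by lra.
    apply (theta5_derive (fun v => Clog (1 - theta5_slope * v))).
    + intros E. rewrite E in Hw. simpl in Hw. lra.
    + eapply C_derive_eq; [exact (C_derive_comp Clog (fun v => 1 - theta5_slope * v) _ _ _ (C_derive_log _ Hw)
        (C_derive_theta5_base w))|]. reflexivity.
  - apply jet2_phi5. now apply locally_singleton in Hs.
  - replace (1 - theta5_slope * 0) with (RtoC 1) by ring. apply Cpower_one.
  - unfold phi5, phi5_num. rewrite Cmult_0_r. unfold Cdiv. ring.
  - revert Hs. apply filter_imp. intros w Hw. rewrite !RtoC_div by lra.
    now apply phi5_relations.
Qed.

(** * The covering in the coordinates 1/x and 1/phi5, and the second identity *)

Definition psi5_S (x : C) : C := 8 + (-4 + 3 * Ci) * x.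
Definition psi5_T (x : C) : C := 4 - (2 + 11 * Ci) * x.
(** The reversed polynomial x^3 P(1/x); likewise [psi5_S] is x s(1/x) and [psi5_T] is x Q(1/x). *)
Definition psi5_P (x : C) : C :=
  32 + (-48 + 336 * Ci) * x + (98 - 336 * Ci) * x ^ 2 - (41 + 38 * Ci) * x ^ 3.
Definition psi5_P' (x : C) : C :=
  (-48 + 336 * Ci) + 2 * (98 - 336 * Ci) * x - 3 * (41 + 38 * Ci) * x ^ 2.
(* 1 / phi5 (1 / x) as a quotient of polynomials *)
Definition psi5 (x : C) : C :=
  x * psi5_S x ^ 5 / (4 * Ci * (1 - x) * psi5_T x ^ 4).
Definition psi5_D1 (x : C) : C :=
  - (Ci / 4) * psi5_P x * psi5_S x ^ 4 / ((1 - x) ^ 2 * psi5_T x ^ 5).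
Definition psi5_D2 (x : C) : C :=
  - (Ci / 4) * psi5_S x ^ 3
  * ((psi5_P' x * psi5_S x + 4 * (-4 + 3 * Ci) * psi5_P x) * (1 - x) * psi5_T x
     + psi5_P x * psi5_S x * (2 * psi5_T x + 5 * (2 + 11 * Ci) * (1 - x)))
  / ((1 - x) ^ 3 * psi5_T x ^ 6).
(** The logarithmic derivative of the prefactor in the second identity. The exponents 1/40 and 11/40
    of [E6] at infinity become 1/40 and 11/40 at the simple pole 1 of [psi5], and 1/10 and 11/10 at
    the fourfold pole; the prefactor shifts the smaller one to 0 at each. *)
Definition psi5_l (x : C) : C :=
  1 / 40 / (1 - x) + 1 / 10 * (2 + 11 * Ci) / psi5_T x.
Definition psi5_l1 (x : C) : C :=
  1 / 40 / (1 - x) ^ 2 + 1 / 10 * ((2 + 11 * Ci) / psi5_T x) ^ 2.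
Definition psi5_K (x : C) : C := - Ci * psi5_S x ^ 3 / ((1 - x) * psi5_T x ^ 2).

(** The exponent differences 1/5, 1/2, -1/4 are, up to sign, those of [E5] with 0 and infinity
    exchanged, in accordance with the passage from phi5 to its inverse. *)
Definition E6 : hge := Hge (1 / 40) (11 / 40) (4 / 5).
Definition E6' : hge := Hge (3 / 20) (2 / 5) (4 / 5).

Lemma psi5_relations (x : C) : 1 - x <> 0 -> psi5_T x <> 0 ->
  pullback_relations E6 E6' (psi5_K x)
    x (psi5 x) (psi5_D1 x) (psi5_D2 x) (psi5_l x) (psi5_l1 x).
Proof.
  intros H1 H2. unfold E6, E6'; repeat split; simpl hgA; simpl hgB; simpl hgC;
    unfold psi5_K, psi5, psi5_D1, psi5_D2, psi5_l, psi5_l1, psi5_P, psi5_P', psi5_S, psi5_T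
      in *; gauss_field.
Qed.

Lemma psi5_regular_near (x : C) : 1 - x <> 0 -> psi5_T x <> 0 ->
  locally x (fun w => 1 - w <> 0 /\ psi5_T w <> 0).
Proof.
  intros H1 H2. apply filter_and.
  - apply (locally_neq_0 (fun w => 1 - w) x (- (1))); [C_derive; ring|exact H1].
  - apply (locally_neq_0 psi5_T x (- (2 + 11 * Ci))); [unfold psi5_T; C_derive; ring|exact H2].
Qed.

Lemma jet2_psi5 (x : C) : 1 - x <> 0 -> psi5_T x <> 0 -> jet2 psi5 psi5_D1 psi5_D2 x.
Proof.
  intros H1 H2. unfold jet2. generalize (psi5_regular_near x H1 H2). apply filter_imp.
  clear x H1 H2. intros x [H1 H2].
  assert (HCi := Ci_neq_0).
  assert (H4 : RtoC 4 <> 0) by (intros E; apply RtoC_inj in E; lra).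
  split.
  - unfold psi5, psi5_S, psi5_T. C_derive.
    + apply Cmult_neq_0; [repeat apply Cmult_neq_0; assumption|now apply Cpow_nz].
    + unfold psi5_D1, psi5_P, psi5_S, psi5_T in *.
      cbn [Z.of_nat Pos.of_succ_nat Pos.succ]. gauss_field.
  - unfold psi5_D1, psi5_P, psi5_S, psi5_T. C_derive.
    + apply Cmult_neq_0; now apply Cpow_nz.
    + unfold psi5_D2, psi5_P, psi5_P', psi5_S, psi5_T in *.
      cbn [Z.of_nat Pos.of_succ_nat Pos.succ]. gauss_field.
Qed.

Lemma C_derive_psi5_l (x : C) : 1 - x <> 0 -> psi5_T x <> 0 ->
  is_derive psi5_l x (psi5_l1 x).
Proof.
  intros H1 H2. unfold psi5_l, psi5_T. C_derive; try assumption.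
  unfold psi5_l1, psi5_T in *. gauss_field.
Qed.

Lemma phi5_P1_P1inv (x : C) : 1 - x <> 0 -> psi5_T x <> 0 -> psi5_S x <> 0 ->
  phi5_P1 (P1inv (Fin x)) = P1inv (Fin (psi5 x)).
Proof.
  intros H1 H2 H3.
  assert (HCi := Ci_neq_0).
  assert (H4 : RtoC 4 <> 0) by (intros F; apply RtoC_inj in F; lra).
  assert (HN : 4 * Ci * (1 - x) * psi5_T x ^ 4 <> 0)
    by (apply Cmult_neq_0; [repeat apply Cmult_neq_0; assumption|now apply Cpow_nz]).
  unfold P1inv. destruct (Ceq_dec x 0) as [->|Hx].
  (* At x = 0 both sides are infinity: phi5 fixes infinity, and [psi5] vanishes at 0. *)
  - destruct (Ceq_dec (psi5 0) 0) as [_|n]; [reflexivity|]. destruct n.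
    unfold psi5. rewrite Cmult_0_l. unfold Cdiv. ring.
  - assert (Es : phi5_s (/ x) = psi5_S x / x) by (unfold phi5_s, psi5_S; now field).
    assert (EQ : phi5_Q (/ x) = psi5_T x / x) by (unfold phi5_Q, psi5_T; now field).
    assert (Hs : phi5_s (/ x) <> 0).
    { rewrite Es. apply Cmult_neq_0; [exact H3|]. now apply Cinv_neq_0. }
    rewrite phi5_P1_Fin by exact Hs.
    destruct (Ceq_dec (psi5 x) 0) as [F|F].
    + exfalso. revert F. unfold psi5. apply Cmult_neq_0; [|now apply Cinv_neq_0].
      apply Cmult_neq_0; [exact Hx|now apply Cpow_nz].
    + f_equal. change (phi5 (/ x))
        with (4 * Ci * / x * (/ x - 1) * phi5_Q (/ x) ^ 4 / phi5_s (/ x) ^ 5).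
      rewrite EQ, Es. unfold psi5. field. auto.
Qed.

Lemma toC_P1inv_P1inv (z : C) : toC (P1inv (P1inv (Fin z))) = z.
Proof.
  unfold P1inv. destruct (Ceq_dec z 0) as [->|Hz]; [reflexivity|].
  destruct (Ceq_dec (/ z) 0) as [F|F]; [now apply Cinv_neq_0 in F|].
  simpl. now field.
Qed.

Lemma hyp2F1_identity_psi5 : locally (0 : C) (fun x : C =>
  hyp2F1 (3 / 20) (2 / 5) (4 / 5) x =
  Cpower (1 - x) (- (1 / 40))
  * Cpower (1 - (2 + 11 * Ci) / 4 * x) (- (1 / 10))
  * hyp2F1 (1 / 40) (11 / 40) (4 / 5)
      (toC (P1inv (phi5_P1 (P1inv (Fin x)))))).
Proof.
  set (k := (2 + 11 * Ci) / 4).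
  assert (D1 : forall w : C, is_derive (fun x => 1 - x) w (- (1))) by (intros w; C_derive; ring).
  assert (D2 : forall w : C, is_derive (fun x => 1 - k * x) w (- k)) by (intros w; C_derive; ring).
  assert (P1 : locally (0 : C) (fun w => (0 < Re (1 - w)%C)%R)).
  { apply (locally_Re_pos (fun w => 1 - w) 0 _ (D1 0)).
    replace (1 - 0) with (RtoC 1) by ring. simpl. lra. }
  assert (P2 : locally (0 : C) (fun w => (0 < Re (1 - k * w)%C)%R)).
  { apply (locally_Re_pos (fun w => 1 - k * w) 0 _ (D2 0)).
    replace (1 - k * 0) with (RtoC 1) by ring. simpl. lra. }
  assert (HS : locally (0 : C) (fun w => psi5_S w <> 0)).
  { apply (locally_neq_0 psi5_S 0 (-4 + 3 * Ci)); [unfold psi5_S; C_derive; ring|].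
    unfold psi5_S. replace (8 + (-4 + 3 * Ci) * 0) with (RtoC 8) by ring.
    intros E. apply RtoC_inj in E. lra. }
  assert (H1 : 1 - 0 <> 0).
  { replace (1 - 0) with (RtoC 1) by ring. exact C1_nz. }
  assert (H2 : psi5_T 0 <> 0).
  { unfold psi5_T. replace (4 - (2 + 11 * Ci) * 0) with (RtoC 4) by ring.
    intros E. apply RtoC_inj in E. lra. }
  assert (HR := psi5_regular_near 0 H1 H2).
  assert (HI : locally (0 : C) (fun x : C =>
    hyp2F1 (3 / 20) (2 / 5) (4 / 5) x =
    Cpower (1 - x) (- (1 / 40)) * Cpower (1 - k * x) (- (1 / 10))
    * hyp2F1 (1 / 40) (11 / 40) (4 / 5) (psi5 x))).
  { rewrite <- !RtoC_div by lra.
    apply (hyp2F1_pullback (1 / 40) (11 / 40) (4 / 5) (3 / 20) (2 / 5) (4 / 5)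
      (fun x => Cpower (1 - x) (- (1 / 40)%R) * Cpower (1 - k * x) (- (1 / 10)%R))
      psi5_l psi5_l1 psi5 psi5_D1 psi5_D2 psi5_K); try lra.
    - generalize (filter_and _ _ (filter_and _ _ P1 P2) HR). apply filter_imp.
      intros w [[Hw1 Hw2] [Hw3 Hw4]]. split; [|now apply C_derive_psi5_l].
      eapply C_derive_eq.
      + exact (C_derive_mult _ _ _ _ _ (C_derive_Cpower (fun x => 1 - x) _ _ _ Hw1 (D1 w))
                 (C_derive_Cpower (fun x => 1 - k * x) _ _ _ Hw2 (D2 w))).
      + cbv beta. rewrite !RtoC_div by lra.
        assert (ET : 1 - k * w = psi5_T w / 4) by (unfold k, psi5_T; field).
        unfold psi5_l. rewrite ET.
        generalize (Cpower (1 - w) (- (1 / 40))) (Cpower (psi5_T w / 4) (- (1 / 10))).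
        intros p q. unfold k. field. auto.
    - now apply jet2_psi5.
    - replace (1 - k * 0) with (RtoC 1) by ring. replace (1 - 0) with (RtoC 1) by ring.
      rewrite !Cpower_one. ring.
    - unfold psi5. rewrite Cmult_0_l. unfold Cdiv. ring.
    - revert HR. apply filter_imp. intros w [Hw3 Hw4]. rewrite !RtoC_div by lra.
      now apply psi5_relations. }
  generalize (filter_and _ _ HI (filter_and _ _ HR HS)). apply filter_imp.
  intros w (E & (Hw1 & Hw2) & Hw3). now rewrite phi5_P1_P1inv, toC_P1inv_P1inv.
Qed.

(** * The fibres of phi5 *)

Definition factor_product (fs : list (C * nat)) (x : C) : C :=
  fold_right (fun rm v => (x - fst rm) ^ snd rm * v) 1 fs.

Lemma factor_product_cons (r : C) (m : nat) (fs : list (C * nat)) (x : C) :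
  factor_product ((r, m) :: fs) x = (x - r) ^ m * factor_product fs x.
Proof. reflexivity. Qed.

Lemma factor_product_map (rs : list C) (x : C) (m : nat) :
  factor_product (map (fun r => (r, m)) rs) x = root_product rs x ^ m.
Proof.
  induction rs as [|r rs IH]; cbn [map].
  - symmetry. apply Cpow_1_l.
  - rewrite factor_product_cons, IH. symmetry. apply Cpow_mult_l.
Qed.

Lemma factor_product_middle (fs1 fs2 : list (C * nat)) (r : C) (m : nat) (x : C) :
  factor_product (fs1 ++ (r, m) :: fs2) x = (x - r) ^ m * factor_product (fs1 ++ fs2) x.
Proof.
  induction fs1 as [|[s n] fs1 IH]; cbn [app]; [reflexivity|].
  rewrite !factor_product_cons, IH. ring.
Qed.

Lemma factor_product_neq_0 (fs : list (C * nat)) (x : C) :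
  ~ In x (map fst fs) -> factor_product fs x <> 0.
Proof.
  induction fs as [|[r m] fs IH]; simpl; intros H; [exact C1_nz|].
  apply Cmult_neq_0; [|apply IH; tauto].
  apply Cpow_nz. intros E. apply H. left.
  replace x with (x - r + r) by ring. rewrite E. ring.
Qed.

Lemma factor_product_root (fs : list (C * nat)) (x : C) :
  List.Forall (fun rm => (0 < snd rm)%nat) fs -> In x (map fst fs) -> factor_product fs x = 0.
Proof.
  induction fs as [|[r m] fs IH]; intros HF Hx; simpl in Hx; [tauto|].
  inversion HF as [|? ? Hm HF']; subst. simpl in Hm. destruct Hx as [->|Hx].
  - destruct m as [|m]; [lia|]. rewrite factor_product_cons, Cpow_S. ring.
  - rewrite factor_product_cons, (IH HF' Hx). ring.
Qed.

Lemma factor_product_derive (fs : list (C * nat)) (x : C) :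
  exists l, is_derive (factor_product fs) x l.
Proof.
  induction fs as [|[r [|m]] fs [l Hl]].
  - exists (RtoC 0). apply C_derive_const.
  - exists l. apply (C_derive_ext_loc (factor_product fs)); [|exact Hl].
    apply filter_forall. intros w. simpl. now rewrite Cmult_1_l.
  - eexists. apply (C_derive_mult (fun w => (w - r) ^ S m) (factor_product fs));
      [|exact Hl].
    eapply (fun l => C_derive_pow (fun w => w - r) x l m), (C_derive_minus (fun w => w));
      [apply C_derive_id|apply C_derive_const].
Qed.

(** A repeated root a gives f = k (x - a)^2 g, hence a common zero of f and its derivative. *)
Lemma root_product_NoDup (f f' : C -> C) (k : C) (rs : list C) :
  (forall x, f x = k * root_product rs x) -> (forall x, is_derive f x (f' x)) ->
  (forall x, f x = 0 -> f' x <> 0) -> NoDup rs.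
Proof.
  intros Hf Hf' H. destruct (NoDup_dec Ceq_dec rs) as [|ND]; [assumption|exfalso].
  assert (dec : forall x y : C, x = y \/ x <> y)
    by (intros x y; destruct (Ceq_dec x y); auto).
  apply (not_NoDup dec) in ND. destruct ND as (a & l1 & l2 & l3 & E).
  set (fs1 := map (fun r => (r, 1%nat)) l1). set (fs2 := map (fun r => (r, 1%nat)) l2).
  set (fs3 := map (fun r => (r, 1%nat)) l3).
  assert (F : forall x, f x
    = k * ((x - a) * ((x - a) * factor_product (fs1 ++ fs2 ++ fs3) x))).
  { intros x. rewrite Hf, <- (Cpow_1_r (root_product rs x)), <- factor_product_map, E.
    rewrite map_app. simpl map. rewrite map_app. simpl map. fold fs1 fs2 fs3.
    rewrite factor_product_middle, app_assoc, factor_product_middle, <- app_assoc.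
    rewrite !Cpow_1_r. ring. }
  apply (H a).
  - rewrite F. ring.
  - destruct (factor_product_derive (fs1 ++ fs2 ++ fs3) a) as [l Hl].
    assert (D : is_derive f a (RtoC 0)).
    { apply (C_derive_ext_loc (fun x => k * ((x - a) * ((x - a)
        * factor_product (fs1 ++ fs2 ++ fs3) x)))).
      - apply filter_forall. intros x. now rewrite F.
      - C_derive. ring. }
    apply is_C_derive_unique in D. rewrite <- D. symmetry.
    apply is_C_derive_unique, Hf'.
Qed.

Lemma phi5_num_neq_0 (x : C) : phi5_s x = 0 -> phi5_num x <> 0.
Proof.
  intros E.
  assert (Hx : x = (4 - 3 * Ci) / 8).
  { replace x with ((phi5_s x + (4 - 3 * Ci)) / 8) by (unfold phi5_s; field).
    rewrite E. field. }
  rewrite Hx. unfold phi5_num.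
  (* The value of the numerator at the pole is -(5^10 / 2^8) i. *)
  match goal with |- ?y <> _ => replace y with (- (9765625 / 256) * Ci) by field end.
  intros F. apply (f_equal Im) in F. simpl in F. lra.
Qed.

Lemma phi5_den_eq_0 (x : C) : phi5_den x = 0 -> phi5_s x = 0.
Proof.
  intros H. destruct (Ceq_dec (phi5_s x) 0) as [E|E]; [exact E|].
  exfalso. revert H. apply Cpow_nz, E.
Qed.

(** At a pole neither side holds, because numerator and denominator have no common zero; finite
    fibres are therefore exactly zero sets of polynomials. *)
Lemma phi5_P1_eq_Fin (x q : C) :
  phi5_P1 (Fin x) = Fin q <-> phi5_num x - q * phi5_den x = 0.
Proof.
  simpl. destruct (Ceq_dec (phi5_den x) 0) as [E|E]; split; intros H.
  - discriminate.
  - exfalso. apply (phi5_num_neq_0 x); [now apply phi5_den_eq_0|].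
    rewrite <- H, E. ring.
  - injection H as <-. unfold phi5. field. exact E.
  - f_equal. unfold phi5. replace (phi5_num x) with (q * phi5_den x); [field; exact E|].
    replace (phi5_num x) with (phi5_num x - q * phi5_den x + q * phi5_den x) by ring.
    rewrite H. ring.
Qed.

Lemma C_derive_phi5_num (x : C) : is_derive phi5_num x
  (4 * Ci * (phi5_Q x ^ 3 * ((2 * x - 1) * phi5_Q x + 16 * x * (x - 1)))).
Proof.
  unfold phi5_num, phi5_Q. C_derive. cbn [Z.of_nat Pos.of_succ_nat Pos.succ]. ring.
Qed.

Lemma C_derive_phi5_den (x : C) : is_derive phi5_den x (40 * phi5_s x ^ 4).
Proof.
  unfold phi5_den, phi5_s. C_derive. cbn [Z.of_nat Pos.of_succ_nat Pos.succ]. ring.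
Qed.

Lemma C_derive_phi5_P (x : C) : is_derive phi5_P x (phi5_P' x).
Proof.
  unfold phi5_P, phi5_P'. C_derive. cbn [Z.of_nat Pos.of_succ_nat Pos.succ]. ring.
Qed.

Lemma ex_derive_translate_near_0 (f : C -> C) (r : C) :
  (forall x, exists l, is_derive f x l) ->
  forall t : C, exists l, is_derive (fun t => f (r + t)) t l.
Proof.
  intros Hf t. destruct (Hf (r + t)) as [l Hl]. eexists.
  apply (C_derive_comp f (fun t => r + t)); [exact Hl|].
  apply (C_derive_plus (fun _ => r) (fun t => t)); [apply C_derive_const|apply C_derive_id].
Qed.

Lemma ex_derive_quotient_near (f g : C -> C) (r : C) :
  (forall x, exists l, is_derive f x l) -> (forall x, exists l, is_derive g x l) ->
  g r <> 0 ->
  locally (0 : C) (fun t => g (r + t) <> 0 /\ ex_derive (fun t => f (r + t) / g (r + t)) t).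
Proof.
  intros Hf Hg H0.
  destruct (ex_derive_translate_near_0 g r Hg 0) as [l Hl].
  assert (Hn : locally (0 : C) (fun t => g (r + t) <> 0)).
  { apply (locally_neq_0 (fun t => g (r + t)) 0 l Hl).
    replace (r + 0) with r by ring. exact H0. }
  revert Hn. apply locally_C_imp. intros t Ht. split; [exact Ht|].
  destruct (ex_derive_translate_near_0 f r Hf t) as [lf Hlf].
  destruct (ex_derive_translate_near_0 g r Hg t) as [lg Hlg].
  eexists. apply (C_derive_div (fun t => f (r + t)) (fun t => g (r + t))); eassumption.
Qed.

(** A factorisation with distinct roots yields the ramification data: at r + t, phi5 equals q + t^m
    u(t), where u is the cofactor divided by the denominator and does not vanish at t = 0. *)
Lemma phi5_finite_fibre (q k : C) (fs : list (C * nat)) : k <> 0 ->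
  NoDup (map fst fs) -> List.Forall (fun rm => (0 < snd rm)%nat) fs ->
  (forall x, phi5_num x - q * phi5_den x = k * factor_product fs x) ->
  exists fibre : list (P1 * nat),
    NoDup (map fst fibre) /\
    (forall p, phi5_P1 p = Fin q <-> In p (map fst fibre)) /\
    List.Forall (fun pm => ramification phi5_P1 (fst pm) (snd pm)) fibre /\
    list_sum (map snd fibre) = list_sum (map snd fs).
Proof.
  intros Hk HN Hm HF.
  exists (map (fun rm => (Fin (fst rm), snd rm)) fs).
  assert (E1 : map fst (map (fun rm : C * nat => (Fin (fst rm), snd rm)) fs)
             = map Fin (map fst fs)) by now rewrite !map_map.
  rewrite E1.
  assert (Hroot : forall x, phi5_P1 (Fin x) = Fin q <-> In x (map fst fs)).
  { intros x. rewrite phi5_P1_eq_Fin, HF. split; intros H.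
    - destruct (in_dec Ceq_dec x (map fst fs)) as [|Hn]; [assumption|exfalso].
      revert H. apply Cmult_neq_0; [exact Hk|now apply factor_product_neq_0].
    - rewrite factor_product_root by assumption. ring. }
  split; [|split; [|split]].
  - apply Injective_map_NoDup; [|exact HN]. intros x y H. now injection H.
  - intros [x|].
    + rewrite Hroot. split; [apply in_map|]. rewrite in_map_iff.
      intros (y & Hy & Hin). injection Hy as ->. exact Hin.
    + split; [discriminate|]. rewrite in_map_iff. intros (y & Hy & _). discriminate.
  - rewrite Forall_map, Forall_forall. intros [r m] Hin. simpl fst; simpl snd.
    rewrite Forall_forall in Hm. assert (Hm0 := Hm _ Hin). simpl in Hm0.
    split; [exact Hm0|].
    assert (Hr : phi5_P1 (Fin r) = Fin q) by (apply Hroot, (in_map fst _ _ Hin)).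
    destruct (in_split _ _ Hin) as (fs1 & fs2 & Efs).
    set (G := fun x => k * factor_product (fs1 ++ fs2) x).
    assert (HG : forall x, phi5_num x - q * phi5_den x = (x - r) ^ m * G x).
    { intros x. rewrite HF, Efs, factor_product_middle. unfold G. ring. }
    assert (HGr : G r <> 0).
    { unfold G. apply Cmult_neq_0; [exact Hk|]. apply factor_product_neq_0.
      rewrite Efs, map_app in HN. simpl map in HN. apply NoDup_remove_2 in HN.
      now rewrite map_app. }
    assert (HD : phi5_den r <> 0).
    { intros E. simpl in Hr. destruct (Ceq_dec (phi5_den r) 0); [discriminate|tauto]. }
    assert (DG : forall x, exists l, is_derive G x l).
    { intros x. destruct (factor_product_derive (fs1 ++ fs2) x) as [l Hl]. eexists.
      apply (C_derive_mult (fun _ => k)); [apply C_derive_const|exact Hl]. }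
    assert (HL := ex_derive_quotient_near G phi5_den r DG
      (fun x => ex_intro _ _ (C_derive_phi5_den x)) HD).
    exists (fun t => G (r + t) / phi5_den (r + t)). split; [|split].
    + revert HL. apply locally_C_imp. tauto.
    + replace (r + 0) with r by ring. apply Cmult_neq_0; [exact HGr|now apply Cinv_neq_0].
    + rewrite Hr. revert HL. apply locally_C_imp. intros t [Ht _]. simpl.
      destruct (Ceq_dec (phi5_den (r + t)) 0) as [|_]; [tauto|]. f_equal. unfold phi5.
      assert (E := HG (r + t)). replace (r + t - r) with t in E by ring.
      transitivity (q + (t ^ m * G (r + t)) / phi5_den (r + t)); [|field; exact Ht].
      rewrite <- E. field. exact Ht.
  - now rewrite map_map.
Qed.

Lemma Cmult_reg_r (a b d : C) : d <> 0 -> a * d = b * d -> a = b.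
Proof.
  intros Hd H. replace a with (a * d / d) by (field; exact Hd). rewrite H. field. exact Hd.
Qed.

Definition phi5_pole : C := (4 - 3 * Ci) / 8.

Lemma phi5_s_pole (t : C) : phi5_s (phi5_pole + t) = 8 * t.
Proof. unfold phi5_s, phi5_pole. field. Qed.

Lemma phi5_s_eq_0 (x : C) : phi5_s x = 0 -> x = phi5_pole.
Proof.
  intros E. replace x with (phi5_s x / 8 + phi5_pole) by (unfold phi5_s, phi5_pole; field).
  rewrite E. field.
Qed.

Lemma phi5_s_phi5_pole : phi5_s phi5_pole = 0.
Proof.
  replace phi5_pole with (phi5_pole + 0) by ring. rewrite phi5_s_pole. ring.
Qed.

(** Since s = 8 t at distance t from the pole, 1 / phi5 = t^5 (8^5 / num) with num nonzero at the
    pole. *)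
Lemma phi5_ramification_pole : ramification phi5_P1 (Fin phi5_pole) 5.
Proof.
  split; [lia|].
  assert (H8 : RtoC 8 <> 0) by (intros E; apply RtoC_inj in E; lra).
  assert (E1 : (8 * 0) ^ 5 = 0) by ring.
  assert (E2 : forall z : C, 0 ^ 5 * z = 0) by (intros; ring).
  assert (HN : phi5_num phi5_pole <> 0) by (apply phi5_num_neq_0, phi5_s_phi5_pole).
  assert (HL := ex_derive_quotient_near (fun _ => 8 ^ 5) phi5_num phi5_pole
    (fun x => ex_intro _ _ (C_derive_const _ x))
    (fun x => ex_intro _ _ (C_derive_phi5_num x)) HN).
  exists (fun t => 8 ^ 5 / phi5_num (phi5_pole + t)). split; [|split].
  - revert HL. apply locally_C_imp. tauto.
  - replace (phi5_pole + 0) with phi5_pole by ring.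
    apply Cmult_neq_0; [now apply Cpow_nz|now apply Cinv_neq_0].
  - revert HL. apply locally_C_imp. intros t [Ht _].
    assert (ED : phi5_den (phi5_pole + t) = (8 * t) ^ 5).
    { rewrite <- phi5_s_pole. reflexivity. }
    replace (phi5_P1 (Fin phi5_pole)) with Inf.
    2:{ simpl. destruct (Ceq_dec (phi5_den phi5_pole) 0) as [_|n]; [reflexivity|].
        destruct n. change (phi5_s phi5_pole ^ 5 = 0). rewrite phi5_s_phi5_pole. ring. }
    cbn [param phi5_P1]. rewrite ED. unfold P1inv, phi5. rewrite ED.
    destruct (Ceq_dec t 0) as [->|Ht0].
    + destruct (Ceq_dec ((8 * 0) ^ 5) 0) as [_|n]; [|destruct n; exact E1].
      destruct (Ceq_dec (0 ^ 5 * (8 ^ 5 / phi5_num (phi5_pole + 0))) 0) as [_|n]; [reflexivity|destruct n; apply E2].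
    + destruct (Ceq_dec ((8 * t) ^ 5) 0) as [E|_].
      { exfalso. revert E. now apply Cpow_nz, Cmult_neq_0. }
      destruct (Ceq_dec (t ^ 5 * (8 ^ 5 / phi5_num (phi5_pole + t))) 0) as [E|_].
      { exfalso. revert E. apply Cmult_neq_0; [now apply Cpow_nz|].
        apply Cmult_neq_0; [now apply Cpow_nz|now apply Cinv_neq_0]. }
      f_equal. field. auto.
Qed.

(** In the coordinate t = 1/x the covering is [psi5], which has a simple zero at 0 because [psi5_S]
    has the value 8 there. *)
Lemma phi5_ramification_Inf : ramification phi5_P1 Inf 1.
Proof.
  split; [lia|].
  set (D := fun x => 4 * Ci * (1 - x) * psi5_T x ^ 4).
  assert (HD : D 0 <> 0).
  { unfold D, psi5_T.
    replace (4 * Ci * (1 - 0) * (4 - (2 + 11 * Ci) * 0) ^ 4) with (1024 * Ci) by ring.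
    intros F. apply (f_equal Im) in F. simpl in F. lra. }
  assert (HS0 : psi5_S 0 = 8) by (unfold psi5_S; ring).
  assert (H8 : RtoC 8 <> 0) by (intros E; apply RtoC_inj in E; lra).
  assert (H4 : RtoC 4 <> 0) by (intros E; apply RtoC_inj in E; lra).
  assert (DS : forall x, exists l, is_derive (fun x => psi5_S x ^ 5) x l).
  { intros x. unfold psi5_S. eexists. C_derive_step. }
  assert (DD : forall x, exists l, is_derive D x l).
  { intros x. unfold D, psi5_T. eexists. C_derive_step. }
  assert (HL := ex_derive_quotient_near _ D 0 DS DD HD).
  exists (fun t => psi5_S (0 + t) ^ 5 / D (0 + t)). split; [|split].
  - revert HL. apply locally_C_imp. tauto.
  - replace (0 + 0) with (RtoC 0) by ring. rewrite HS0.
    apply Cmult_neq_0; [now apply Cpow_nz|now apply Cinv_neq_0].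
  - assert (HR := psi5_regular_near 0).
    assert (HS : locally (0 : C) (fun w => psi5_S w <> 0)).
    { apply (locally_neq_0 psi5_S 0 (-4 + 3 * Ci)); [unfold psi5_S; C_derive; ring|].
      now rewrite HS0. }
    assert (H1 : 1 - 0 <> 0) by (replace (1 - 0) with (RtoC 1) by ring; exact C1_nz).
    assert (H2 : psi5_T 0 <> 0).
    { unfold psi5_T. now replace (4 - (2 + 11 * Ci) * 0) with (RtoC 4) by ring. }
    generalize (filter_and _ _ (HR H1 H2) HS). apply locally_C_imp.
    intros t [[Ht1 Ht2] Ht3]. change (param Inf t) with (P1inv (Fin t)).
    rewrite phi5_P1_P1inv by assumption. cbn [param phi5_P1].
    f_equal. f_equal. replace (0 + t) with t by ring. unfold psi5, D. simpl.
    unfold Cdiv. ring.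
Qed.

(** The denominator has degree 5 only, so the leading coefficient 1024 i is independent of q and
    every finite fibre polynomial has degree 6. *)
Lemma phi5_num_degree6 (x q : C) : phi5_num x - q * phi5_den x
  = Cpeval ([0 - q * (3116 - 237 * Ci);
     (-41184 - 47012 * Ci) - q * (-21080 - 13440 * Ci);
     (117920 + 1060 * Ci) - q * (28160 + 74880 * Ci);
     (-59840 + 90880 * Ci) - q * (35840 - 122880 * Ci);
     (-28160 - 42880 * Ci) - q * (-81920 + 61440 * Ci);
     (11264 - 3072 * Ci) - q * 32768] ++ [1024 * Ci]) x.
Proof. unfold phi5_num, phi5_den. simpl Cpeval. ring. Qed.

(* The numerator of phi5' is 4 i Q^3 P s^4. *)
Lemma phi5_wronskian (x : C) :
  4 * Ci * (phi5_Q x ^ 3 * ((2 * x - 1) * phi5_Q x + 16 * x * (x - 1))) * phi5_den x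
  - phi5_num x * (40 * phi5_s x ^ 4) = 4 * Ci * phi5_Q x ^ 3 * phi5_P x * phi5_s x ^ 4.
Proof. unfold phi5_num, phi5_den, phi5_Q, phi5_s, phi5_P. ring. Qed.

Lemma is_covering_phi5 : is_covering phi5_P1 6.
Proof.
  assert (H1024 : 1024 * Ci <> 0)
    by (intros F; apply (f_equal Im) in F; simpl in F; lra).
  intros [q|].
  - destruct (Ceq_dec q 0) as [->|Hq0]; [|destruct (Ceq_dec q 1) as [->|Hq1]].
    + apply (phi5_finite_fibre 0 (1024 * Ci)
        [(RtoC 0, 1%nat); (RtoC 1, 1%nat); ((2 + 11 * Ci) / 4, 4%nat)]).
      * exact H1024.
      * assert (N1 : forall z : C, Im ((2 + 11 * Ci) / 4) <> Im z ->
          (2 + 11 * Ci) / 4 <> z) by (intros z H E; apply H; now rewrite E).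
        replace ((2 + 11 * Ci) / 4) with ((1 / 2)%R, (11 / 4)%R)
          by (unfold Ci; apply injective_projections; simpl; field).
        repeat constructor; simpl; intros F.
        -- destruct F as [F|[F|[]]]; apply (f_equal fst) in F; simpl in F; lra.
        -- destruct F as [F|[]]; apply (f_equal fst) in F; simpl in F; lra.
        -- exact F.
      * repeat constructor.
      * intros x. unfold phi5_num. simpl factor_product. field.
    (* Over 1 the fibre polynomial is i P^2, and 32^2 = 1024: the three roots of P count twice
       each. *)
    + destruct (FundamentalTheorem.Cpeval_roots
        [- (41 + 38 * Ci); 98 - 336 * Ci; -48 + 336 * Ci] 32) as (rs & Hlen & Hrs).
      { intros E; apply RtoC_inj in E; lra. }
      assert (HP : forall x, phi5_P x = 32 * root_product rs x).
      { intros x. rewrite <- Hrs. unfold phi5_P. simpl. ring. }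
      destruct (phi5_finite_fibre 1 (1024 * Ci) (map (fun r => (r, 2%nat)) rs))
        as (fibre & F1 & F2 & F3 & F4).
      * exact H1024.
      * rewrite map_map, map_id.
        apply (root_product_NoDup phi5_P phi5_P' 32 rs HP C_derive_phi5_P).
        intros x HPx HPx'.
        (* Bezout relation between P and P' *)
        assert (B : (36 - 522 * Ci - 72 * x) * phi5_P x
          + (22 - 129 * Ci + (-24 + 258 * Ci) * x + 24 * x ^ 2) * phi5_P' x = -62500)
          by (unfold phi5_P, phi5_P'; ring).
        rewrite HPx, HPx' in B. apply (f_equal Re) in B. simpl in B. lra.
      * rewrite Forall_map. apply Forall_forall. intros. simpl. lia.
      * intros x. rewrite factor_product_map.
        replace (phi5_num x - 1 * phi5_den x) with (- (phi5_den x - phi5_num x)) by ring.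
        rewrite phi5_den_minus_num, HP. ring.
      * exists fibre. repeat (split; [assumption|]). rewrite F4, map_map. simpl.
        destruct rs as [|r1 [|r2 [|r3 [|r4 rs]]]]; try discriminate. reflexivity.
    + destruct (FundamentalTheorem.Cpeval_roots
        [0 - q * (3116 - 237 * Ci);
         (-41184 - 47012 * Ci) - q * (-21080 - 13440 * Ci);
         (117920 + 1060 * Ci) - q * (28160 + 74880 * Ci);
         (-59840 + 90880 * Ci) - q * (35840 - 122880 * Ci);
         (-28160 - 42880 * Ci) - q * (-81920 + 61440 * Ci);
         (11264 - 3072 * Ci) - q * 32768] (1024 * Ci) H1024) as (rs & Hlen & Hrs).
      assert (HF : forall x, phi5_num x - q * phi5_den x = 1024 * Ci * root_product rs x)
        by (intros x; rewrite phi5_num_degree6; apply Hrs).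
      destruct (phi5_finite_fibre q (1024 * Ci) (map (fun r => (r, 1%nat)) rs))
        as (fibre & F1 & F2 & F3 & F4).
      * exact H1024.
      * rewrite map_map, map_id.
        eapply (root_product_NoDup _ _ _ rs HF).
        { intros x. apply (C_derive_minus phi5_num (fun x => q * phi5_den x));
            [apply C_derive_phi5_num|].
          apply (C_derive_mult (fun _ => q) phi5_den);
            [apply C_derive_const|apply C_derive_phi5_den]. }
        cbv beta. intros x Hx Hx'.
        assert (EN : phi5_num x = q * phi5_den x).
        { replace (phi5_num x) with (phi5_num x - q * phi5_den x + q * phi5_den x) by ring.
          rewrite Hx. ring. }
        assert (HD : phi5_den x <> 0).
        { intros E. apply (phi5_num_neq_0 x); [now apply phi5_den_eq_0|].
          rewrite EN, E. ring. }
        assert (Hs : phi5_s x <> 0).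
        { intros E. apply HD. change (phi5_s x ^ 5 = 0). rewrite E. ring. }
        (* A multiple root would be a zero of the Wronskian, hence of Q or of P as s is nonzero; the
           first forces q = 0, the second q = 1. *)
        assert (W := phi5_wronskian x).
        set (N1 := 4 * Ci * (phi5_Q x ^ 3 * ((2 * x - 1) * phi5_Q x + 16 * x * (x - 1))))
          in *.
        assert (EW : N1 * phi5_den x - phi5_num x * (40 * phi5_s x ^ 4) = 0).
        { rewrite EN. transitivity
            ((N1 - (0 * phi5_den x + q * (40 * phi5_s x ^ 4))) * phi5_den x); [ring|].
          rewrite Hx'. ring. }
        rewrite EW in W. symmetry in W. revert W.
        apply Cmult_neq_0; [|now apply Cpow_nz]. apply Cmult_neq_0.
        { apply Cmult_neq_0.
          - intros F; apply (f_equal Im) in F; simpl in F; lra.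
          - apply Cpow_nz. intros EQ. apply Hq0.
            apply (Cmult_reg_r _ 0 (phi5_den x) HD). rewrite <- EN.
            change (phi5_num x) with (4 * Ci * x * (x - 1) * phi5_Q x ^ 4).
            rewrite EQ. ring. }
        intros EP. apply Hq1. apply (Cmult_reg_r _ 1 (phi5_den x) HD).
        rewrite <- EN.
        replace (phi5_num x) with (phi5_den x - (phi5_den x - phi5_num x)) by ring.
        rewrite phi5_den_minus_num, EP. ring.
      * rewrite Forall_map. apply Forall_forall. intros. simpl. lia.
      * intros x. rewrite factor_product_map, Cpow_1_r. apply HF.
      * exists fibre. repeat (split; [assumption|]). rewrite F4, map_map. simpl.
        destruct rs as [|r1 [|r2 [|r3 [|r4 [|r5 [|r6 [|r7 rs]]]]]]]; try discriminate.
        reflexivity.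
  - exists [(Fin phi5_pole, 5%nat); (Inf, 1%nat)]. split; [|split; [|split]].
    + repeat constructor; simpl; intuition discriminate.
    + intros [x|]; simpl; [|tauto].
      destruct (Ceq_dec (phi5_den x) 0) as [E|E]; split; intros H.
      * left. f_equal. symmetry. now apply phi5_s_eq_0, phi5_den_eq_0.
      * reflexivity.
      * discriminate.
      * destruct H as [H|[H|[]]]; [|discriminate]. exfalso. injection H as <-.
        apply E. change (phi5_s phi5_pole ^ 5 = 0). rewrite phi5_s_phi5_pole. ring.
    + apply List.Forall_cons; [exact phi5_ramification_pole|].
      apply List.Forall_cons; [exact phi5_ramification_Inf|]. apply List.Forall_nil.
    + reflexivity.
Qed.

Theorem mainTheorem6 :
  is_covering phi5_P1 6 /\
  (exists E E' : hge,
     has_exponent_differences E [1 / 2; 1 / 4; 1 / 5] /\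
     has_exponent_differences E' [1 / 4; 1 / 4; 1 / 5] /\
     defines_pullback phi5_P1 E E') /\
  locally (0 : C) (fun x : C =>
    hyp2F1 (3 / 20) (7 / 20) (3 / 4) x =
    Cpower (1 - 8 * (4 + 3 * Ci) / 25 * x) (- (1 / 8))
    * hyp2F1 (1 / 40) (9 / 40) (3 / 4) (phi5 x)) /\
  locally (0 : C) (fun x : C =>
    hyp2F1 (3 / 20) (2 / 5) (4 / 5) x =
    Cpower (1 - x) (- (1 / 40))
    * Cpower (1 - (2 + 11 * Ci) / 4 * x) (- (1 / 10))
    * hyp2F1 (1 / 40) (11 / 40) (4 / 5)
        (toC (P1inv (phi5_P1 (P1inv (Fin x)))))).
Proof.
  split; [exact is_covering_phi5|]. split; [|split].
  - exists E5, E5'. split; [|split; [|exact defines_pullback_phi5]].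
    (* The order is that of the points 0, 1 and infinity; the sign change in the last place comes
       from A < B. *)
    + exists [1 / 4; 1 / 2; 1 / 5]. split; [constructor|].
      apply List.Forall2_cons; [left; simpl; field|].
      apply List.Forall2_cons; [left; simpl; field|].
      apply List.Forall2_cons; [right; simpl; field|apply List.Forall2_nil].
    + exists [1 / 4; 1 / 4; 1 / 5]. split; [apply Permutation_refl|].
      apply List.Forall2_cons; [left; simpl; field|].
      apply List.Forall2_cons; [left; simpl; field|].
      apply List.Forall2_cons; [right; simpl; field|apply List.Forall2_nil].
  - exact hyp2F1_identity_phi5.
  - exact hyp2F1_identity_psi5.
Qed.
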